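(* Let $d\in\mathbb{N}$, let $\Lambda\subset[0,\infty)$ be an additive semigroup with $0\in\Lambda$, and let $\omega$ be an admissible weight on $\Lambda$. An element $f\in\mathcal{D}(\Lambda,\omega,M_d(\mathbb{C}))$ has an inverse in $\mathcal{D}(\Lambda,\omega,M_d(\mathbb{C}))$ if and only if $\overline{\{f(s):s\in\mathcal{H}\}}\subset GL_d(\mathbb{C})$.
   Context: $\mathcal{H}=\{s\in\mathbb C:\operatorname{Re}s\geq 0\}$. $M_d(\mathbb C)$ is the Banach algebra of complex $d\times d$ matrices with operator norm, unit $I_d$; $GL_d(\mathbb C)$ is the set of invertible matrices. A weight on $\Lambda$ is a map $\omega:\Lambda\to[1,\infty)$ with $\omega(0)=1$ and $\omega(\lambda_1+\lambda_2)\le\omega(\lambda_1)\omega(\lambda_2)$ for all $\lambda_1,\lambda_2\in\Lambda$; it is admissible if $\lim_{n\to\infty}\omega(n\lambda)^{1/n}=1$ for all $\lambda\in\Lambda$. For a unital Banach algebra $\mathcal A$, $\mathcal D(\Lambda,\omega,\mathcal A)$ is the set of functions $f:\mathcal H\to\mathcal A$ of the form $f(s)=\sum_{\lambda\in\Lambda}f_\lambda e^{-\lambda s}$ with $f_\lambda\in\mathcal A$ and $\|f\|_\omega=\sum_{\lambda\in\Lambda}\|f_\lambda\|\omega(\lambda)<\infty$; it is a unital Banach algebra under pointwise multiplication and $\|\cdot\|_\omega$. *)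

(* Defs.v *)
From HB Require Import structures.
From mathcomp Require Import all_boot all_order all_algebra.
From mathcomp Require Import all_classical all_reals all_analysis.
From mathcomp Require Import complex finmap.
Import Order.TTheory GRing.Theory Num.Theory.
Import numFieldNormedType.Exports.
Set Implicit Arguments.
Unset Strict Implicit.
Unset Printing Implicit Defensive.
Local Open Scope classical_set_scope.
Local Open Scope ring_scope.

(* The complex numbers over a real field R, viewed (through the ^o alias)
   with their normed/topological structure from MathComp-Analysis. *)
Definition C (R : realType) : Type := (R[i])^o.

Definition Hplane (R : realType) : set (C R) :=
  [set s : C R | 0 <= complex.Re (s : R[i])].
Arguments Hplane R : clear implicits.

(* e^{-lam s} for real lam and complex s = a + i b:
   e^{-lam a} (cos (lam b) - i sin (lam b)). *)
Definition expneg (R : realType) (lam : R) (s : C R) : C R :=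
  let a := complex.Re (s : R[i]) in
  let b := complex.Im (s : R[i]) in
  (Complex (expR (- (lam * a)) * cos (lam * b))
           (- (expR (- (lam * a)) * sin (lam * b))) : R[i]).

Definition vnorm (R : realType) (d : nat) (v : 'cV[C R]_d) : R :=
  Num.sqrt (\sum_(i < d) (complex.Re (v i ord0 : R[i]) ^+ 2
                          + complex.Im (v i ord0 : R[i]) ^+ 2)).

Definition opnorm (R : realType) (d : nat) (A : 'M[C R]_d) : R :=
  sup [set vnorm (A *m v) | v in [set v : 'cV[C R]_d | vnorm v <= 1]].

Definition semigroup0 (R : realType) (Lam : set R) : Prop :=
  [/\ Lam 0, (forall l, Lam l -> 0 <= l)
    & (forall l1 l2, Lam l1 -> Lam l2 -> Lam (l1 + l2))].

(* A weight on Lam (only its values on Lam matter). *)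
Definition is_weight (R : realType) (Lam : set R) (w : R -> R) : Prop :=
  [/\ w 0 = 1, (forall l, Lam l -> 1 <= w l)
    & (forall l1 l2, Lam l1 -> Lam l2 -> w (l1 + l2) <= w l1 * w l2)].

Definition admissible (R : realType) (Lam : set R) (w : R -> R) : Prop :=
  forall l, Lam l -> (fun n : nat => w (n%:R * l) `^ (n%:R)^-1) @ \oo --> (1 : R).

Definition totally {I : choiceType} : set_system {fset I} :=
  filter_from setT (fun A => [set B | (A `<=` B)%fset]).

Instance totally_filter {I : choiceType} : ProperFilter (@totally I).
Proof.
eapply filter_from_proper; last by move=> A _; exists A; rewrite /= fsubset_refl.
apply: filter_fromT_filter; first by exists fset0.
by move=> A B /=; exists (A `|` B)%fset => P /=; rewrite fsubUset => /andP[].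
Qed.

Definition dpartial (R : realType) (d : nat) (Lam : set R)
  (a : R -> 'M[C R]_d) (s : C R) (J : {fset R}) : 'M[C R]_d :=
  \sum_(l <- J | `[< Lam l >]) (expneg l s *: a l).

Definition inD (R : realType) (d : nat) (Lam : set R) (w : R -> R)
  (F : C R -> 'M[C R]_d) : Prop :=
  exists a : R -> 'M[C R]_d,
    (\esum_(l in Lam) ((opnorm (a l) * w l)%:E) < +oo)%E /\
    forall s, Hplane R s -> dpartial Lam a s @ totally --> F s.

(* Main.v *)
Require Import Defs.
From HB Require Import structures.
From mathcomp Require Import all_boot all_order all_algebra.
From mathcomp Require Import all_classical all_reals all_analysis.
From mathcomp Require Import complex finmap ring lra.
Import Order.TTheory GRing.Theory Num.Theory.
Import numFieldNormedType.Exports.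
Local Open Scope classical_set_scope.
Local Open Scope ring_scope.

(** The matrix [F s] is inverted by Cramer's rule, so everything reduces to a scalar [f = det F] with [|f| >= d > 0] on the half-plane: a compactness argument turns the closure condition into such a bound, and conversely.

For the scalar case write [f = p + r] with [p] a Dirichlet polynomial and [r] small in norm; then [1/f = sum_n (-r)^n p^(-n-1)] converges as soon as the norms of [p^(-n)] grow no faster than [sup |1/p|^n], up to a constant. The frequencies of [1/p] lie in a finitely generated semigroup [G]. If [q] has an absolutely convergent series over [G] then its coefficients are bounded by [sup |q|] (mean values along vertical lines), hence the series of [q(s + h)], [h > 0], has norm at most [sup |q|] times [sum_(l in G) w(l) e^(-l h)], which is finite because [w] is admissible. Applied to [q = p^(-n)] on [Re s >= -h], where [|p|] is still bounded below, this gives the required growth.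

That [1/p] has an absolutely convergent series on [Re s >= -h] holds far to the right, where the constant term dominates, and is propagated to the left by steps of fixed length [h]: comparing [p(s + k)] with [p(s + k + 2 h)], the same series for the inverse converges. *)

Set Implicit Arguments.
Unset Strict Implicit.
Unset Printing Implicit Defensive.

Local Notation modc := (@ComplexField.Normc.normc _).

(** * The real-valued modulus of complex numbers *)

Section ComplexModulus.
Variable R : realType.
Implicit Types (x y z : R[i]).

Lemma modc_ge0 x : 0 <= modc x.
Proof. by case: x => a b; exact: sqrtr_ge0. Qed.

Lemma modcD x y : modc (x + y) <= modc x + modc y.
Proof. exact: (@le_normcD R x y). Qed.

Lemma modcN x : modc (- x) = modc x.
Proof. exact: (@normcN R x). Qed.

Lemma modcM x y : modc (x * y) = modc x * modc y.
Proof. exact: ComplexField.Normc.normcM. Qed.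

Lemma modc0 : modc (0 : R[i]) = 0.
Proof. exact: ComplexField.Normc.normc0. Qed.

Lemma modc1 : modc (1 : R[i]) = 1.
Proof. exact: ComplexField.Normc.normc1. Qed.

Lemma modcV x : modc x^-1 = (modc x)^-1.
Proof. exact: ComplexField.Normc.normcV. Qed.

Lemma modc_eq0 x : (modc x == 0) = (x == 0).
Proof.
apply/eqP/eqP => [|->]; [exact: ComplexField.Normc.eq0_normc | exact: modc0].
Qed.

Lemma modc_gt0 x : (0 < modc x) = (x != 0).
Proof. by rewrite lt0r modc_eq0 modc_ge0 andbT. Qed.

Lemma modcX x n : modc (x ^+ n) = modc x ^+ n.
Proof. by elim: n => [|n IH]; rewrite ?expr0 ?modc1// !exprS modcM IH. Qed.

Lemma modcBC x y : modc (x - y) = modc (y - x).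
Proof. by rewrite -modcN opprB. Qed.

Lemma modc_triangle z x y : modc (x - y) <= modc (x - z) + modc (z - y).
Proof. by rewrite -[x - y](subrKA z); exact: modcD. Qed.

Lemma modc_sum (I : Type) (r : seq I) (P : pred I) (F : I -> R[i]) :
  modc (\sum_(i <- r | P i) F i) <= \sum_(i <- r | P i) modc (F i).
Proof.
elim/big_ind2: _ => [|x a y b ha hb|//]; first by rewrite modc0.
exact: le_trans (modcD _ _) (lerD ha hb).
Qed.

Lemma modc_real (a : R) : modc (a%:C)%C = `|a|.
Proof. by rewrite /= expr0n addr0 sqrtr_sqr. Qed.

Lemma modc_geRe x : `|complex.Re x| <= modc x.
Proof.
by case: x => a b /=; rewrite -sqrtr_sqr ler_wsqrtr// lerDl sqr_ge0.
Qed.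

Lemma modc_geIm x : `|complex.Im x| <= modc x.
Proof.
by case: x => a b /=; rewrite -sqrtr_sqr ler_wsqrtr// lerDr sqr_ge0.
Qed.

Lemma modc_leReIm x : modc x <= `|complex.Re x| + `|complex.Im x|.
Proof.
case: x => a b /=; rewrite -ler_sqr ?nnegrE ?sqrtr_ge0 ?addr_ge0//.
rewrite sqr_sqrtr ?addr_ge0 ?sqr_ge0// sqrrD !real_normK ?num_real//.
by rewrite -addrA lerD2l lerDr mulrn_wge0// mulr_ge0.
Qed.

Lemma le_modc_eps x (S : R) :
  (forall e, 0 < e -> modc x <= S + e) -> modc x <= S.
Proof. by move=> h; apply/ler_addgt0Pr. Qed.

End ComplexModulus.

(** * The exponentials e^{-l s} and their moduli *)

Section Exponentials.
Variable R : realType.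
Implicit Types (l m : R) (s t : R[i]).

Definition dexp l s : R[i] := expneg l s.

Lemma dexpDl l m s : dexp (l + m) s = dexp l s * dexp m s.
Proof.
rewrite /dexp /expneg; case: s => a b /=.
rewrite !mulrDl opprD expRD cosD sinD.
by apply/eqP; rewrite eq_complex /=; apply/andP; split; apply/eqP; ring.
Qed.

Lemma dexpDr l s t : dexp l (s + t) = dexp l s * dexp l t.
Proof.
rewrite /dexp /expneg; case: s => a b; case: t => c d /=.
rewrite !mulrDr opprD expRD cosD sinD.
by apply/eqP; rewrite eq_complex /=; apply/andP; split; apply/eqP; ring.
Qed.

Lemma dexp0l s : dexp 0 s = 1.
Proof.
by rewrite /dexp /expneg !mul0r oppr0 expR0 cos0 sin0 mulr0 mulr1 oppr0.
Qed.

Lemma dexp_real l (a : R) : dexp l (a%:C)%C = ((expR (- (l * a)))%:C)%C.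
Proof.
by rewrite /dexp /expneg /= mulr0 cos0 sin0 mulr0 oppr0 mulr1.
Qed.

Lemma modc_dexp l s : modc (dexp l s) = expR (- (l * complex.Re s)).
Proof.
rewrite /dexp /expneg /= sqrrN !exprMn -mulrDr cos2Dsin2 mulr1 sqrtr_sqr.
by rewrite gtr0_norm ?expR_gt0.
Qed.

Lemma modc_dexp_le1 l s : 0 <= l -> 0 <= complex.Re s -> modc (dexp l s) <= 1.
Proof.
by move=> l0 s0; rewrite modc_dexp -[leRHS]expR0 ler_expR oppr_le0 mulr_ge0.
Qed.

Lemma modc_dexp_im l (b : R) : modc (dexp l (0 +i* b)%C) = 1.
Proof. by rewrite modc_dexp /= mulr0 oppr0 expR0. Qed.

End Exponentials.

(** * Bounded sums of nonnegative terms and absolutely convergent series *)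

Section Sums.
Variable R : realType.
Implicit Types (J : {fset R}) (e : R).

(** Take [J1] with sum within [e] of the supremum of all finite sums; whatever [J] adds outside [J1]
    has to fit into that gap. *)
Lemma finite_sums_tail (g : R -> R) (c : R) :
  (forall l, 0 <= g l) -> (forall J, \sum_(l <- J) g l <= c) ->
  forall e, 0 < e -> exists J1 : {fset R},
    forall J, \sum_(l <- J | l \notin J1) g l <= e.
Proof.
move=> g0 gc e e0.
pose E : set R := [set x | exists J, x = \sum_(l <- J) g l].
have supE : has_sup E.
  split; first by exists (\sum_(l <- fset0) g l), fset0.
  by exists c => x [J ->].
have [_ [J1 ->] hJ1] := sup_adherent e0 supE.
exists J1 => J.
have hU : \sum_(l <- (J1 `|` J)%fset) g l <= sup E.
  by apply: sup_upper_bound => //; exists (J1 `|` J)%fset.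
rewrite (bigID (mem J1)) /= in hU.
have e1 : \sum_(l <- (J1 `|` J)%fset | l \in J1) g l = \sum_(l <- J1) g l.
  apply: eq_fbigl_cond => l; rewrite !inE/= andbT.
  by case: (l \in J1); rewrite ?andbF.
have e2 : \sum_(l <- (J1 `|` J)%fset | l \notin J1) g l
        = \sum_(l <- J | l \notin J1) g l.
  apply: eq_fbigl_cond => l; rewrite !inE/=.
  by case: (l \in J1); rewrite ?andbF ?andbT.
rewrite e1 e2 in hU; rewrite -(lerD2l (\sum_(l <- J1) g l)).
by apply: le_trans hU _; rewrite -lerBlDr ltW.
Qed.

Lemma bounded_sums_cauchy (g : nat -> R) (c : R) :
  (forall n, 0 <= g n) -> (forall N, \sum_(n < N) g n <= c) ->
  forall e, 0 < e -> exists N, forall M, (N <= M)%N ->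
    \sum_(n < M) g n - \sum_(n < N) g n <= e.
Proof.
move=> g0 gc e e0.
pose E : set R := [set x | exists N : nat, x = \sum_(n < N) g n].
have supE : has_sup E.
  split; first by exists (\sum_(n < 0) g n), 0%N.
  by exists c => x [J ->].
have [_ [N ->] hN] := sup_adherent e0 supE; exists N => M NM.
have : \sum_(n < M) g n <= sup E by apply: sup_upper_bound => //; exists M.
by move: hN; lra.
Qed.

Lemma normed_series_sum_cvg (u : nat -> R) (c : R) :
  (forall N, \sum_(n < N) `|u n| <= c) ->
  exists z, forall e, 0 < e -> exists N0, forall N, (N0 <= N)%N ->
    `|\sum_(n < N) u n - z| <= e.
Proof.
move=> uc.
have cv : cvgn (series u).
  apply: normed_cvg => /=; apply: nondecreasing_is_cvgn.
    by apply/nondecreasing_series => n _ _; exact: normr_ge0.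
  by exists c => _ [N _ <-]; rewrite /= /series/= big_mkord.
exists (limn (series u)) => e e0.
have /cvgrPdist_le/(_ _ e0)[N0 _ hN0] := cv.
exists N0 => N NN; have := hN0 N NN.
by rewrite /= /series/= big_mkord distrC.
Qed.

Lemma modc_series_cvg (u : nat -> R[i]) (c : R) :
  (forall N, \sum_(n < N) modc (u n) <= c) ->
  exists z, forall e, 0 < e -> exists N0, forall N, (N0 <= N)%N ->
    modc (\sum_(n < N) u n - z) <= e.
Proof.
move=> uc.
have [N|x hx] := @normed_series_sum_cvg (fun n => complex.Re (u n)) c.
  by apply: le_trans _ (uc N); apply: ler_sum => n _; exact: modc_geRe.
have [N|y hy] := @normed_series_sum_cvg (fun n => complex.Im (u n)) c.
  by apply: le_trans _ (uc N); apply: ler_sum => n _; exact: modc_geIm.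
exists (x +i* y)%C => e e0; have e2 : 0 < e / 2 by rewrite divr_gt0.
have [N1 h1] := hx _ e2; have [N2 h2] := hy _ e2.
exists (maxn N1 N2) => N; rewrite geq_max => /andP[NN1 NN2].
have eRe : complex.Re (\sum_(n < N) u n - (x +i* y)%C)
    = \sum_(n < N) complex.Re (u n) - x.
  rewrite (raddfB (@complex.Re R : Rcomplex R -> R)); congr (_ - _).
  exact: (raddf_sum (@complex.Re R : Rcomplex R -> R)).
have eIm : complex.Im (\sum_(n < N) u n - (x +i* y)%C)
    = \sum_(n < N) complex.Im (u n) - y.
  rewrite (raddfB (@complex.Im R : Rcomplex R -> R)); congr (_ - _).
  exact: (raddf_sum (@complex.Im R : Rcomplex R -> R)).
have := modc_leReIm (\sum_(n < N) u n - (x +i* y)%C).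
rewrite eRe eIm => /le_trans; apply.
by rewrite [leRHS](splitr e) lerD ?h1 ?h2.
Qed.

End Sums.

(** * Absolutely convergent Dirichlet series *)

Section DirichletAlgebra.
Variable R : realType.
Implicit Types (J : {fset R}) (a : R -> R[i]) (f g h : R[i] -> R[i]).
Implicit Types (Lam : set R) (w : R -> R) (s : R[i]) (c e : R).

(** Convergence along finite sets ordered by inclusion, matching the filter [totally] in [inD]. *)
Definition sums_to a s (z : R[i]) := forall e, 0 < e -> exists J0 : {fset R},
  forall J, (J0 `<=` J)%fset -> modc (\sum_(l <- J) a l * dexp l s - z) <= e.

(** The bound [c] on all finite weighted sums expresses that the norm is at most [c]. Coefficients
    vanish off [Lam], so that sums may run over arbitrary finite sets of reals. *)
Definition has_coefs Lam w c a f :=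
  [/\ forall l, ~ Lam l -> a l = 0,
      forall J, \sum_(l <- J) modc (a l) * w l <= c
    & forall s, 0 <= complex.Re s -> sums_to a s (f s)].

Definition in_ball Lam w c f := exists a, has_coefs Lam w c a f.

Section Weighted.
Variables (Lam : set R) (w : R -> R).
Hypotheses (hLam : semigroup0 Lam) (hw : is_weight Lam w).

Let Lam_ge0 l : Lam l -> 0 <= l. Proof. by case: hLam => _ + _; apply. Qed.
Let w_ge1 l : Lam l -> 1 <= w l. Proof. by case: hw => _ + _; apply. Qed.
Let w_ge0 l : Lam l -> 0 <= w l.
Proof. by move=> /w_ge1; exact: le_trans. Qed.

Lemma coefs_ge0 c a f : has_coefs Lam w c a f -> forall l, 0 <= modc (a l) * w l.
Proof.
case=> a0 _ _ l; have [/w_ge0 wl|/a0 ->] := pselect (Lam l).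
  by rewrite mulr_ge0 ?modc_ge0.
by rewrite modc0 mul0r.
Qed.

Lemma in_ball_ge0 c f : in_ball Lam w c f -> 0 <= c.
Proof. by case=> a [_ /(_ fset0) + _]; rewrite big_seq_fset0. Qed.

Lemma coefs_term_le c a f l s : has_coefs Lam w c a f -> 0 <= complex.Re s ->
  modc (a l * dexp l s) <= modc (a l) * w l.
Proof.
case=> a0 _ _ s0; have [Ll|/a0 ->] := pselect (Lam l); last first.
  by rewrite !mul0r modc0 mul0r.
rewrite modcM ler_wpM2l ?modc_ge0//.
by rewrite (le_trans (modc_dexp_le1 (Lam_ge0 Ll) s0)) ?w_ge1.
Qed.

(** On the half-plane |e^{-l s}| <= 1 <= w(l), so the weighted tail of the coefficients bounds the
    error of the partial sums uniformly in [s]. *)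
Lemma coefs_approx c a f : has_coefs Lam w c a f -> forall e, 0 < e ->
  exists J1 : {fset R}, (forall J, \sum_(l <- J | l \notin J1) modc (a l) * w l <= e) /\
    forall J, (J1 `<=` J)%fset -> forall s, 0 <= complex.Re s ->
      modc (\sum_(l <- J) a l * dexp l s - f s) <= e.
Proof.
move=> af e e0; have [_ ac afs] := af.
have [J1 hJ1] := finite_sums_tail (coefs_ge0 af) ac e0.
exists J1; split=> // J JJ1 s s0; apply: le_modc_eps => e' e'0.
have [J0 hJ0] := afs s s0 e' e'0.
have {}hJ0 := hJ0 (J `|` J0)%fset (fsubsetUr _ _).
apply: le_trans
  (modc_triangle (\sum_(l <- (J `|` J0)%fset) a l * dexp l s) _ _) (lerD _ hJ0).
rewrite [X in modc (_ - X)](bigID (mem J)) /=.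
have -> : \sum_(l <- (J `|` J0)%fset | l \in J) a l * dexp l s
    = \sum_(l <- J) a l * dexp l s.
  apply: eq_fbigl_cond => l; rewrite !inE/= andbT.
  by case: (l \in J); rewrite ?andbF.
rewrite opprD addrA subrr add0r modcN; apply: le_trans (modc_sum _ _ _) _.
apply: le_trans (hJ1 (J `|` J0)%fset).
rewrite [leLHS]big_mkcond [leRHS]big_mkcond; apply: ler_sum => l _.
have := coefs_ge0 af l; have := coefs_term_le l af s0.
have [lJ /=|lJ /=] := boolP (l \in J); first by case: ifP.
by rewrite (contra (fsubsetP JJ1 l) lJ).
Qed.

Lemma in_ball_bound c f s : in_ball Lam w c f -> 0 <= complex.Re s ->
  modc (f s) <= c.
Proof.
case=> a af s0; have [_ ac afs] := af; apply: le_modc_eps => e e0.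
have [J hJ] := afs s s0 e e0; have {}hJ := hJ J (fsubset_refl _).
rewrite -[f s]subr0; apply: le_trans (modc_triangle (\sum_(l <- J) a l * dexp l s) _ _) _.
rewrite addrC subr0 modcBC lerD//; apply: le_trans (modc_sum _ _ _) _.
by apply: le_trans (ac J); apply: ler_sum => l _; exact: coefs_term_le af s0.
Qed.

Lemma in_ball_le c c' f : c <= c' -> in_ball Lam w c f -> in_ball Lam w c' f.
Proof.
by move=> cc' [a [a0 ac af]]; exists a; split=> // J; exact: le_trans cc'.
Qed.

Lemma in_ball_ext c f g : (forall s, 0 <= complex.Re s -> f s = g s) ->
  in_ball Lam w c f -> in_ball Lam w c g.
Proof.
by move=> fg [a [a0 ac af]]; exists a; split=> // s s0; rewrite -fg//; exact: af.
Qed.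

Lemma in_ball_sub (Lam' : set R) c f : Lam' `<=` Lam ->
  in_ball Lam' w c f -> in_ball Lam w c f.
Proof.
move=> LL [a [a0 ac af]]; exists a; split=> // l Ll; apply: a0.
by move=> Ll'; apply: Ll; exact: LL.
Qed.

Lemma in_ball0 : in_ball Lam w 0 (fun _ => 0).
Proof.
exists (fun _ => 0); split=> // [J|s _ e e0].
  by rewrite big1// => l _; rewrite modc0 mul0r.
exists fset0 => J _; rewrite big1 ?subr0 ?modc0 1?ltW// => l _.
by rewrite mul0r.
Qed.

Lemma in_ballD c1 c2 f g : in_ball Lam w c1 f -> in_ball Lam w c2 g ->
  in_ball Lam w (c1 + c2) (fun s => f s + g s).
Proof.
move=> [a [a0 ac af]] [b [b0 bc bg]].
exists (fun l => a l + b l); split=> [l Ll|J|s s0 e e0].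
- by rewrite a0 ?b0 ?addr0.
- apply: le_trans (lerD (ac J) (bc J)); rewrite -big_split /=.
  apply: ler_sum => l _; have [Ll|Ll] := pselect (Lam l).
    by rewrite -mulrDl ler_wpM2r ?w_ge0 ?modcD.
  by rewrite a0 ?b0// addr0 modc0 !mul0r addr0.
have e2 : 0 < e / 2 by rewrite divr_gt0.
have [J1 h1] := af s s0 _ e2; have [J2 h2] := bg s s0 _ e2.
exists (J1 `|` J2)%fset => J; rewrite fsubUset => /andP[/h1{}h1 /h2{}h2].
under eq_bigr do rewrite mulrDl.
rewrite big_split /= opprD addrACA [leRHS]splitr.
exact: le_trans (modcD _ _) (lerD h1 h2).
Qed.

Lemma in_ball_sum (I : Type) (r : seq I) (P : pred I) (F : I -> R[i] -> R[i])
    (C : I -> R) : (forall i, P i -> in_ball Lam w (C i) (F i)) ->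
  in_ball Lam w (\sum_(i <- r | P i) C i) (fun s => \sum_(i <- r | P i) F i s).
Proof.
move=> FC; elim: r => [|i r IH].
  rewrite big_nil; apply: in_ball_ext in_ball0 => s _; by rewrite big_nil.
rewrite big_cons; case: ifP => Pi; last first.
  by apply: in_ball_ext IH => s _; rewrite big_cons Pi.
by apply: in_ball_ext (in_ballD (FC i Pi) IH) => s _; rewrite big_cons Pi.
Qed.

Lemma in_ball_monomial (t : R[i]) l : Lam l ->
  in_ball Lam w (modc t * w l) (fun s => t * dexp l s).
Proof.
move=> Ll; exists (fun m => if m == l then t else 0).
split=> [m Lm|J|s s0 e e0].
- by case: eqP => // ml; rewrite ml in Lm.
- have [lJ|lJ] := boolP (l \in J).
    rewrite (big_fsetD1 l)//= eqxx big1_fset ?addr0// => m.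
    by rewrite !inE => /andP[/negbTE -> _] _; rewrite modc0 mul0r.
  rewrite big1_fset ?mulr_ge0 ?w_ge0 ?modc_ge0// => m mJ _.
  by case: eqP => [ml|_]; [rewrite -ml mJ in lJ|rewrite modc0 mul0r].
exists [fset l]%fset => J; rewrite fsub1set => lJ.
rewrite (big_fsetD1 l)//= eqxx big1_fset ?addr0 ?subrr ?modc0 1?ltW// => m.
by rewrite !inE => /andP[/negbTE -> _] _; rewrite mul0r.
Qed.

Lemma in_ball_cst (t : R[i]) : in_ball Lam w (modc t) (fun=> t).
Proof.
have [L0 _ _] := hLam; have [w0 _ _] := hw.
have := in_ball_monomial t L0; rewrite w0 mulr1.
by apply: in_ball_ext => s _; rewrite dexp0l mulr1.
Qed.

(** Completeness of the weighted algebra: the coefficients converge one frequency at a time,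
    dominated by the norm bounds [C n], and their limits represent the pointwise limit [f]. *)
Lemma in_ball_series (F : nat -> R[i] -> R[i]) (C : nat -> R) c f :
  (forall n, in_ball Lam w (C n) (F n)) ->
  (forall N, \sum_(n < N) C n <= c) ->
  (forall s, 0 <= complex.Re s -> forall e, 0 < e -> exists N0, forall N,
    (N0 <= N)%N -> modc (\sum_(n < N) F n s - f s) <= e) ->
  in_ball Lam w c f.
Proof.
move=> FC Cc Ff; have C0 n := in_ball_ge0 (FC n).
have [b hb] := choice FC.
have b_sum J n : \sum_(l <- J) modc (b n l) * w l <= C n.
  by have [_ + _] := hb n; apply.
have b_lim l : exists z, (~ Lam l -> z = 0) /\ forall e, 0 < e -> exists N0,
    forall N, (N0 <= N)%N -> modc (\sum_(n < N) b n l - z) <= e.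
  have [Ll|Ll] := pselect (Lam l); last first.
    exists 0; split=> // e e0; exists 0%N => N _.
    rewrite big1 ?subr0 ?modc0 1?ltW// => n _.
    by have [/(_ l Ll)] := hb n.
  have [N|z hz] := @modc_series_cvg R (b ^~ l) c; last by exists z.
  apply: le_trans (Cc N); apply: ler_sum => n _.
  apply: le_trans (b_sum [fset l]%fset n); rewrite big_seq_fset1.
  by rewrite ler_peMr ?modc_ge0 ?w_ge1.
have [a ha] := choice b_lim.
have a0 l : ~ Lam l -> a l = 0 by case: (ha l) => + _; apply.
pose S N l := \sum_(n < N) b n l.
have S0 N l : ~ Lam l -> S N l = 0.
  by move=> Ll; apply: big1 => n _; have [/(_ l Ll)] := hb n.
have wS (x : R -> R[i]) : (forall l, ~ Lam l -> x l = 0) ->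
    forall l, 0 <= modc (x l) * w l.
  move=> x0 l; have [Ll|Ll] := pselect (Lam l).
    by rewrite mulr_ge0 ?w_ge0 ?modc_ge0.
  by rewrite x0// modc0 mul0r.
have S_lim (r : seq R) e : 0 < e -> exists N0, forall N, (N0 <= N)%N ->
    \sum_(l <- r) modc (a l - S N l) * w l <= e.
  elim: r e => [|l r IH] e e0; first by exists 0%N => N _; rewrite big_nil ltW.
  have e2 : 0 < e / 2 by rewrite divr_gt0.
  have [N1 h1] := IH _ e2.
  have [Ll|Ll] := pselect (Lam l); last first.
    exists N1 => N /h1 hN; rewrite big_cons a0// S0// subrr modc0 mul0r add0r.
    by apply: le_trans hN _; move: e0; lra.
  have wl : 0 < w l by exact: lt_le_trans (w_ge1 Ll).
  have [|N2 h2] := (ha l).2 (e / 2 / w l); first by rewrite divr_gt0.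
  exists (maxn N1 N2) => N; rewrite geq_max => /andP[/h1{}h1 /h2{}h2].
  by rewrite big_cons [leRHS]splitr lerD// -ler_pdivlMr// modcBC.
(* To estimate [a - S N] on a finite [J], pass through [S M] with [M] large: [a - S M] is small on
   [J], and [S M - S N] costs at most the sum of [C n] over N <= n < M. *)
have tail N e : (forall M, (N <= M)%N -> \sum_(n < M) C n - \sum_(n < N) C n <= e) ->
    forall J, \sum_(l <- J) modc (a l - S N l) * w l <= e.
  move=> hN J; apply/ler_addgt0Pr => e' e'0.
  have [N0 hN0] := S_lim J e' e'0; pose M := (N + N0)%N.
  have {}hN0 := hN0 M (leq_addl _ _); have {}hN := hN M (leq_addr _ _).
  rewrite addrC; apply: le_trans (lerD hN0 hN).
  have -> : \sum_(n < M) C n - \sum_(n < N) C n = \sum_(N <= n < M) C n.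
    rewrite -(big_mkord xpredT C) -(big_mkord xpredT C).
    by rewrite (@big_cat_nat _ _ _ N 0%N M)/= ?leq_addr// addrAC subrr add0r.
  apply: le_trans (_ : \sum_(l <- J) modc (a l - S M l) * w l +
      \sum_(l <- J) \sum_(N <= n < M) modc (b n l) * w l <= _); last first.
    by rewrite lerD2l exchange_big /=; apply: ler_sum => n _.
  rewrite -big_split /=; apply: ler_sum => l _.
  have [Ll|Ll] := pselect (Lam l); last first.
    rewrite a0// !S0// subrr modc0 !mul0r add0r; apply: sumr_ge0 => n _.
    by apply: wS => k Lk; have [/(_ k Lk)] := hb n.
  rewrite -mulr_suml -mulrDl ler_wpM2r ?w_ge0//.
  apply: le_trans (modc_triangle (S M l) _ _) _; rewrite lerD2l.
  have -> : S M l - S N l = \sum_(N <= n < M) b n l.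
    rewrite /S -(big_mkord xpredT (b ^~ l)) -(big_mkord xpredT (b ^~ l)).
    by rewrite (@big_cat_nat _ _ _ N 0%N M)/= ?leq_addr// addrAC subrr add0r.
  exact: modc_sum.
exists a; split=> // [J|s s0 e e0].
  (* The norm bound is [tail] at N = 0, where [S] vanishes. *)
  have -> : \sum_(l <- J) modc (a l) * w l
      = \sum_(l <- J) modc (a l - S 0%N l) * w l.
    by apply: eq_bigr => l _; rewrite /S big_ord0 subr0.
  by apply: tail => M _; rewrite big_ord0 subr0.
(* One third each for replacing [a] by [S N], for comparing the finite sums of [S N] with the first
   [N] functions, and for comparing these with [f s]. *)
have e3 : 0 < e / 3 by rewrite divr_gt0.
have [N1 h1] := bounded_sums_cauchy C0 Cc e3.
have [N2 h2] := Ff s s0 _ e3; pose N := (N1 + N2)%N.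
have {}h1 : forall M, (N <= M)%N -> \sum_(n < M) C n - \sum_(n < N) C n <= e / 3.
  move=> M NM; apply: le_trans (h1 M (leq_trans (leq_addr _ _) NM)).
  rewrite lerD2l lerN2 -(big_mkord xpredT C) -(big_mkord xpredT C).
  rewrite (@big_cat_nat _ _ _ N1 0%N N)/= ?leq_addr//.
  by rewrite lerDl; apply: sumr_ge0.
have {}h2 := h2 N (leq_addl _ _).
have {}tail := tail N _ h1.
have fin : exists J0 : {fset R}, forall J, (J0 `<=` J)%fset ->
    modc (\sum_(l <- J) S N l * dexp l s - \sum_(n < N) F n s) <= e / 3.
  have /(_ _ e3)// : sums_to (S N) s (\sum_(n < N) F n s).
  rewrite /S; elim: N {h1 h2 tail} => [|N IH] e' e'0.
    exists fset0 => J _; rewrite [X in _ - X]big_ord0 big1 ?subr0 ?modc0 1?ltW// => l _.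
    by rewrite big_ord0 mul0r.
  have e2 : 0 < e' / 2 by rewrite divr_gt0.
  have [J1 k1] := IH _ e2; have [_ _ /(_ s s0 _ e2)[J2 k2]] := hb N.
  exists (J1 `|` J2)%fset => J; rewrite fsubUset => /andP[/k1{}k1 /k2{}k2].
  under eq_bigr do rewrite big_ord_recr /= mulrDl.
  rewrite big_split /= big_ord_recr /= opprD addrACA [leRHS]splitr.
  exact: le_trans (modcD _ _) (lerD k1 k2).
have [J0 hJ0] := fin; exists J0 => J /hJ0{}hJ0.
have -> : e = e / 3 + (e / 3 + e / 3) by field.
apply: le_trans (modc_triangle (\sum_(l <- J) S N l * dexp l s) _ _) (lerD _ _).
  rewrite -sumrB; apply: le_trans (modc_sum _ _ _) _.
  apply: le_trans (tail J); apply: ler_sum => l _; rewrite -mulrBl.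
  have [Ll|Ll] := pselect (Lam l); last first.
    by rewrite a0// S0// subrr mul0r modc0 mul0r.
  rewrite modcM ler_wpM2l ?modc_ge0//.
  by rewrite (le_trans (modc_dexp_le1 (Lam_ge0 Ll) s0)) ?w_ge1.
exact: le_trans (modc_triangle _ _ _) (lerD hJ0 h2).
Qed.

(** The polynomial collects the terms in a finite set beyond which the weighted coefficients sum to
    at most [e]. *)
Lemma in_ball_approx c f (e : R) : in_ball Lam w c f -> 0 < e ->
  exists r : seq (R * R[i]), (forall x, x \in r -> Lam x.1) /\
    in_ball Lam w e (fun s => f s - \sum_(x <- r) x.2 * dexp x.1 s).
Proof.
move=> [a af] e0; have [a0 _ afs] := af.
have [J1 [tail _]] := coefs_approx af e0.
exists [seq (l, a l) | l <- J1 & `[< Lam l >]]; split.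
  by move=> _ /mapP[l + ->] /=; rewrite mem_filter => /andP[/asboolP].
exists (fun l => if l \in J1 then 0 else a l); split.
- by move=> l /a0 ->; case: ifP.
- move=> J; apply: le_trans (tail J); rewrite [leRHS]big_mkcond /=.
  apply: ler_sum => l _; case: (l \in J1); last exact: lexx.
  by rewrite modc0 mul0r lexx.
move=> s s0 e' e'0; have [J0 hJ0] := afs s s0 e' e'0.
exists (J0 `|` J1)%fset => J JJ; have [J0J J1J] : (J0 `<=` J)%fset /\ (J1 `<=` J)%fset.
  by move: JJ; rewrite fsubUset => /andP[].
have := hJ0 J J0J; congr (modc _ <= _).
rewrite opprB addrA; congr (_ - _).
rewrite big_map big_filter [X in _ = _ + X](_ : _ = \sum_(l <- J1) a l * dexp l s).
  rewrite (bigID (mem J1)) /= addrC.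
  rewrite [X in _ = X + _](bigID (mem J1)) /=.
  rewrite [X in _ = (X + _) + _]big1; last first.
    by move=> l ->; rewrite mul0r.
  rewrite add0r; congr (_ + _).
    by apply: eq_bigr => l /negbTE ->.
  apply: eq_fbigl_cond => l; rewrite !inE/= andbT.
  by have [/(fsubsetP J1J) ->|] := boolP (l \in J1); rewrite ?andbF.
rewrite big_mkcond; apply: eq_bigr => l _.
by case: asboolP => // /a0 ->; rewrite mul0r.
Qed.

End Weighted.
End DirichletAlgebra.

(** * Products and the Neumann series for inverses *)

Section Multiplication.
Variable R : realType.
Implicit Types (J : {fset R}) (a : R -> R[i]) (f g h : R[i] -> R[i]).
Variables (Lam : set R) (w : R -> R).
Hypotheses (hLam : semigroup0 Lam) (hw : is_weight Lam w).

Lemma eventually_inv_le (e : R) : 0 < e -> exists k : nat, k.+1%:R^-1 <= e.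
Proof.
move=> e0; exists (Num.truncn e^-1); rewrite invf_ple ?posrE ?ltr0n//.
by rewrite ltW// truncnS_gt.
Qed.

(* [f] is cut into finite blocks whose partial sums exhaust its coefficients. *)
Lemma in_ball_mul_of_monomial (c K : R) f h : 0 <= K ->
  (forall (t : R[i]) l, Lam l ->
     in_ball Lam w (modc t * w l * K) (fun s => t * dexp l s * h s)) ->
  in_ball Lam w c f -> in_ball Lam w (c * K) (fun s => f s * h s).
Proof.
move=> K0 hK [a af]; have [a0 ac _] := af.
have J_ex n : exists J1 : {fset R}, forall J, (J1 `<=` J)%fset ->
    forall s, 0 <= complex.Re s ->
    modc (\sum_(l <- J) a l * dexp l s - f s) <= n.+1%:R^-1.
  have n0 : 0 < n.+1%:R^-1 :> R by rewrite invr_gt0 ltr0n.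
  by have [J1 [_ ?]] := coefs_approx hLam hw af n0; exists J1.
have [J hJ] := choice J_ex.
pose U := fix U n := if n is m.+1 then (U m `|` J m)%fset else fset0.
have US n : (U n `<=` U n.+1)%fset by exact: fsubsetUl.
have JU k N : (k < N)%N -> (J k `<=` U N)%fset.
  elim: N => // N IH; rewrite ltnS leq_eqVlt => /orP[/eqP ->|/IH JU].
    exact: fsubsetUr.
  exact: fsubset_trans JU (US N).
have blocks (V : nmodType) (F : R -> V) N :
    \sum_(n < N) \sum_(l <- U n.+1 | l \notin U n) F l = \sum_(l <- U N) F l.
  elim: N => [|N IH]; first by rewrite big_ord0 big_seq_fset0.
  rewrite big_ord_recr /= IH [RHS](bigID (mem (U N))) /=; congr (_ + _).
  apply: eq_fbigl_cond => l; rewrite !inE/= andbT.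
  by case: (l \in U N); rewrite ?andbF.
apply: (@in_ball_series _ _ _ hLam hw
  (fun n s => \sum_(l <- U n.+1 | l \notin U n) a l * dexp l s * h s)
  (fun n => \sum_(l <- U n.+1 | l \notin U n) modc (a l) * w l * K)).
- move=> n; apply: (@in_ball_sum _ _ _ hw _ _ _
    (fun l s => a l * dexp l s * h s) (fun l => modc (a l) * w l * K)) => l _.
  have [/hK|/a0 ->] := pselect (Lam l); first exact.
  rewrite modc0 !mul0r; apply: in_ball_ext (in_ball0 Lam w) => s _.
  by rewrite !mul0r.
- by move=> N; rewrite blocks -mulr_suml ler_wpM2r.
move=> s s0 e e0.
(* The added 1 keeps the divisor positive when [h s] vanishes. *)
have h0 : 0 < modc (h s) + 1 by rewrite ltr_wpDl ?modc_ge0.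
have [k hk] := eventually_inv_le (divr_gt0 e0 h0).
exists k.+1 => N kN; rewrite blocks -mulr_suml -mulrBl modcM.
apply: (@le_trans _ _ (e / (modc (h s) + 1) * (modc (h s) + 1))).
  apply: ler_pM; rewrite ?modc_ge0 ?lerDl//.
  exact: le_trans (hJ k _ (JU _ _ kN) _ s0) hk.
by rewrite divfK ?gt_eqF.
Qed.

(** Both factors are reduced in turn to monomials, for which frequencies add up and [w] is
    submultiplicative. *)
Lemma in_ballM (c1 c2 : R) f g : in_ball Lam w c1 f -> in_ball Lam w c2 g ->
  in_ball Lam w (c1 * c2) (fun s => f s * g s).
Proof.
have [_ w1 wM] := hw; have [_ _ LamD] := hLam.
have w0 l : Lam l -> 0 <= w l by move=> /w1; exact: le_trans.
move=> fc gc; apply: in_ball_mul_of_monomial fc => [|t l Ll].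
  exact: in_ball_ge0 gc.
suff : in_ball Lam w (c2 * (modc t * w l)) (fun s => g s * (t * dexp l s)).
  by rewrite mulrC; apply: in_ball_ext => s _; rewrite mulrC.
apply: in_ball_mul_of_monomial gc => [|u m Lm]; first by rewrite mulr_ge0 ?modc_ge0 ?w0.
apply: in_ball_le (in_ball_ext _ (in_ball_monomial hw (u * t) (LamD _ _ Lm Ll))).
  rewrite modcM mulrACA ler_wpM2l ?wM//.
  by rewrite mulr_ge0 ?modc_ge0.
by move=> s _; rewrite dexpDl mulrACA.
Qed.

Lemma in_ballX (c : R) f n : in_ball Lam w c f ->
  in_ball Lam w (c ^+ n) (fun s => f s ^+ n).
Proof.
move=> fc; elim: n => [|n IH].
  rewrite expr0 -(modc1 R); apply: in_ball_ext (in_ball_cst hLam hw 1) => s _.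
  by rewrite expr0.
by rewrite exprS; apply: in_ball_ext (in_ballM fc IH) => s _; rewrite exprS.
Qed.

Lemma in_ballN (c : R) f : in_ball Lam w c f -> in_ball Lam w c (fun s => - f s).
Proof.
move=> fc; have := in_ballM (in_ball_cst hLam hw (-1)) fc.
rewrite modcN modc1 mul1r; apply: in_ball_ext => s _; by rewrite mulN1r.
Qed.

Lemma geometric_sum_le (q : R) N : 0 <= q < 1 -> \sum_(n < N) q ^+ n <= (1 - q)^-1.
Proof.
move=> /andP[q0 q1]; have q2 : 0 < 1 - q by rewrite subr_gt0.
rewrite -[leRHS]mul1r ler_pdivlMr// mulrC.
rewrite -[leRHS]subr0.
have -> : (1 - q) * \sum_(n < N) q ^+ n = 1 - q ^+ N.
  by rewrite -opprB mulNr -subrX1 opprB.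
by rewrite lerD2l lerN2 exprn_ge0.
Qed.

Lemma geometric_eventually_le (q e : R) : 0 <= q < 1 -> 0 < e ->
  exists N0, forall N, (N0 <= N)%N -> q ^+ N <= e.
Proof.
move=> /andP[q0 q1] e0.
have q1' : `|q| < 1 by rewrite ger0_norm.
have /cvgrPdist_le/(_ _ e0)[N0 _ h] := cvg_expr q1'.
exists N0 => N NN; have := h N NN.
by rewrite /= sub0r normrN ger0_norm ?exprn_ge0.
Qed.

(* 1/f = sum_n (-r)^n u^(n+1), where r = f - 1/u. *)
Lemma in_ball_inv (rho theta K : R) f u :
  0 <= theta -> rho * theta < 1 ->
  (forall n, in_ball Lam w (K * theta ^+ n) (fun s => u s ^+ n)) ->
  in_ball Lam w rho (fun s => f s - (u s)^-1) ->
  (forall s, 0 <= complex.Re s -> u s != 0) ->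
  (forall s, 0 <= complex.Re s -> f s != 0) ->
  exists c, in_ball Lam w c (fun s => (f s)^-1).
Proof.
move=> th0 rth uK fr u0 f0.
have rho0 := in_ball_ge0 fr.
have q01 : 0 <= rho * theta < 1 by rewrite mulr_ge0.
have K0 : 0 <= K by have := in_ball_ge0 (uK 0%N); rewrite expr0 mulr1.
exists (K * theta * (1 - rho * theta)^-1).
apply: (@in_ball_series _ _ _ hLam hw
  (fun n s => (- (f s - (u s)^-1)) ^+ n * u s ^+ n.+1)
  (fun n => rho ^+ n * (K * theta ^+ n.+1))).
- by move=> n; apply: in_ballM (in_ballX n (in_ballN fr)) (uK n.+1).
- move=> N; have -> : \sum_(n < N) rho ^+ n * (K * theta ^+ n.+1)
      = K * theta * \sum_(n < N) (rho * theta) ^+ n.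
    by rewrite mulr_sumr; apply: eq_bigr => n _; rewrite exprMn exprS; ring.
  by rewrite ler_wpM2l ?mulr_ge0// geometric_sum_le.
move=> s s0 e e0; have [fs us] := (f0 s s0, u0 s s0).
set r := f s - (u s)^-1.
(* Since f u = 1 + r u, the series is geometric with ratio -r u, and its error after [N] terms is
   (-r u)^N / f up to sign. *)
have tel N : \sum_(n < N) (- r) ^+ n * u s ^+ n.+1 - (f s)^-1
    = - ((f s)^-1 * ((- r) ^+ N * u s ^+ N)).
  elim: N => [|N IH]; first by rewrite big_ord0 !expr0 !mulr1 sub0r.
  rewrite big_ord_recr /= addrAC IH !exprS.
  have -> : - r = (u s)^-1 - f s by rewrite opprB.
  field; by rewrite fs us.
have f1 : 0 < modc (f s) by rewrite modc_gt0.
have [|N0 hN0] := geometric_eventually_le (e := e * modc (f s) / (K + 1)) q01.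
  by rewrite divr_gt0 ?mulr_gt0// ltr_wpDl.
exists N0 => N /hN0 hN; rewrite tel modcN modcM modcV mulrC ler_pdivrMr//.
have K1 : 0 < K + 1 by rewrite ltr_wpDl.
rewrite ler_pdivlMr// in hN; apply: le_trans hN; rewrite modcM (modcX (- r)) modcN.
have b1 : modc r <= rho := in_ball_bound hLam hw fr s0.
have b2 : modc (u s ^+ N) <= K * theta ^+ N := in_ball_bound hLam hw (uK N) s0.
apply: (@le_trans _ _ (rho ^+ N * (K * theta ^+ N))).
  by apply: ler_pM => //; rewrite ?exprn_ge0 ?modc_ge0// lerXn2r// nnegrE ?modc_ge0.
rewrite exprMn.
have -> : rho ^+ N * (K * theta ^+ N) = rho ^+ N * theta ^+ N * K by ring.
by rewrite ler_wpM2l ?mulr_ge0 ?exprn_ge0// lerDl.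
Qed.

End Multiplication.

(** * Coefficient bounds and finitely generated frequency semigroups *)

Section CoefficientBound.
Variable R : realType.

Lemma dexp_pi (x : R) : x != 0 -> dexp x (0 +i* (pi / x))%C = - 1.
Proof.
move=> x0; rewrite /dexp /expneg /= mulr0 oppr0 expR0 !mul1r.
rewrite mulrC divfK// cospi sinpi.
by apply/eqP; rewrite eq_complex /= !oppr0 !eqxx.
Qed.

(* Averaging over the shifts [t] and [t + pi / x] keeps [z], kills the frequency [x] and does not increase the supremum. *)
Lemma modc_mean_le (r : seq (R * R[i])) (z : R[i]) (S : R) :
  (forall x, x \in r -> x.1 != 0) ->
  (forall t : R, modc (z + \sum_(x <- r) x.2 * dexp x.1 (0 +i* t)%C) <= S) ->
  modc z <= S.
Proof.
have [n] := ubnP (size r); elim: n r => // n IH [|y r] /= szr r0 hS.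
  by have := hS 0; rewrite big_nil addr0.
have y0 : y.1 != 0 by apply: r0; rewrite inE eqxx.
(* The averaging factors are absorbed into the coefficients, so the induction hypothesis applies to
   a list without [y]. *)
pose r' := [seq (x.1, x.2 * ((1 + dexp x.1 (0 +i* (pi / y.1))%C) / 2)) | x <- r].
apply: (IH r'); first by rewrite size_map.
  by move=> _ /mapP[x xr ->] /=; apply: r0; rewrite inE xr orbT.
move=> t; rewrite big_map /=.
set h := pi / y.1 in r' *.
have dh x : dexp x (0 +i* (t + h))%C = dexp x (0 +i* t)%C * dexp x (0 +i* h)%C.
  by rewrite -dexpDr; congr dexp; apply/eqP; rewrite eq_complex /= addr0 !eqxx.
have h1 := hS t; have h2 := hS (t + h); rewrite !big_cons in h1 h2.
have two : (2 : R[i]) = ((2 : R)%:C)%C by rewrite rmorph_nat.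
have -> : z + \sum_(x <- r) x.2 * ((1 + dexp x.1 (0 +i* h)%C) / 2) * dexp x.1 (0 +i* t)%C
  = ((z + (y.2 * dexp y.1 (0 +i* t)%C + \sum_(x <- r) x.2 * dexp x.1 (0 +i* t)%C))
   + (z + (y.2 * dexp y.1 (0 +i* (t + h))%C
        + \sum_(x <- r) x.2 * dexp x.1 (0 +i* (t + h))%C))) / 2.
  rewrite dh dexp_pi//.
  have -> : \sum_(x <- r) x.2 * ((1 + dexp x.1 (0 +i* h)%C) / 2) * dexp x.1 (0 +i* t)%C
    = (\sum_(x <- r) x.2 * dexp x.1 (0 +i* t)%C
       + \sum_(x <- r) x.2 * dexp x.1 (0 +i* (t + h))%C) / 2.
    rewrite -big_split mulr_suml; apply: eq_bigr => x _; rewrite dh /=.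
    by field.
  by field.
rewrite modcM modcV two modc_real ger0_norm// ler_pdivrMr//.
by apply: le_trans (modcD _ _) _; rewrite mulr_natr mulr2n lerD.
Qed.

(** On the imaginary axis, multiplication by e^{m s} preserves moduli and turns [a m] into the
    constant term of a finite sum close to f(s) e^{m s}; all other frequencies l - m are nonzero, so
    [modc_mean_le] applies. *)
Lemma coef_le_bound (Lam : set R) (w : R -> R) (c S : R) a f m :
  semigroup0 Lam -> is_weight Lam w -> has_coefs Lam w c a f ->
  (forall s, 0 <= complex.Re s -> modc (f s) <= S) -> modc (a m) <= S.
Proof.
move=> hLam hw af fS; apply: le_modc_eps => e e0.
have [J1 [_ hJ1]] := coefs_approx hLam hw af e0.
pose J := (m |` J1)%fset.
pose r := [seq (l - m, a l) | l <- (J `\ m)%fset].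
apply: (@modc_mean_le r).
  move=> _ /mapP[l lJ ->] /=; rewrite subr_eq0.
  by move: lJ; rewrite !inE => /andP[].
move=> t; rewrite big_map /=.
have -> : a m + \sum_(l <- (J `\ m)%fset) a l * dexp (l - m) (0 +i* t)%C
    = (\sum_(l <- J) a l * dexp l (0 +i* t)%C) * dexp (- m) (0 +i* t)%C.
  rewrite [X in _ = X * _](big_fsetD1 m) ?inE ?eqxx//= mulrDl mulr_suml; congr (_ + _).
    by rewrite -mulrA -dexpDl subrr dexp0l mulr1.
  by apply: eq_bigr => l _; rewrite -mulrA -dexpDl.
rewrite modcM modc_dexp_im mulr1.
have t0 : 0 <= complex.Re (0 +i* t)%C by [].
have h := hJ1 J (fsubsetUr _ _) _ t0.
rewrite -[X in modc X](subrK (f (0 +i* t)%C)) [leRHS]addrC.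
exact: le_trans (modcD _ _) (lerD h (fS _ t0)).
Qed.

(** Each coefficient is at most [S] in modulus and the shift multiplies it by e^{-l k}. The new norm
    bound depends on [f] only through its supremum, so for powers of [f] it grows at the rate of the
    supremum; the weight may change from [w0] to [w] on the way. *)
Lemma in_ball_shift (Lam : set R) (w0 w : R -> R) (c S k K : R) f :
  semigroup0 Lam -> is_weight Lam w0 -> is_weight Lam w -> in_ball Lam w0 c f ->
  (forall s, 0 <= complex.Re s -> modc (f s) <= S) -> 0 <= k ->
  (forall J : {fset R}, \sum_(l <- J | `[< Lam l >]) w l * expR (- (l * k)) <= K) ->
  in_ball Lam w (S * K) (fun s => f (s + (k%:C)%C)).
Proof.
move=> hLam hw0 hw [a af] fS k0 hK; have [a0 _ afs] := af.
have S0 : 0 <= S by exact: le_trans (modc_ge0 _) (fS 0 _).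
exists (fun l => a l * ((expR (- (l * k)))%:C)%C); split.
- by move=> l /a0 ->; rewrite mul0r.
- move=> J; apply: le_trans (ler_wpM2l S0 (hK J)).
  rewrite [X in _ <= _ * X]big_mkcond mulr_sumr; apply: ler_sum => l _.
  case: asboolP => [Ll|/a0 ->]; last by rewrite mul0r modc0 !mul0r mulr0.
  rewrite modcM modc_real ger0_norm ?expR_ge0// mulrAC -mulrA.
  apply: ler_wpM2r; last exact: coef_le_bound hLam hw0 af fS.
  by rewrite mulr_ge0 ?expR_ge0//; have [_ /(_ _ Ll) + _] := hw; exact: le_trans.
move=> s s0 e e0.
have sk : 0 <= complex.Re (s + (k%:C)%C).
  by rewrite (raddfD (@complex.Re R : Rcomplex R -> R)) addr_ge0.
have [J0 hJ0] := afs _ sk e e0; exists J0 => J /hJ0.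
congr (modc (_ - _) <= _); apply: eq_bigr => l _.
by rewrite dexpDr dexp_real -mulrA (mulrC (dexp _ _)).
Qed.

End CoefficientBound.

(** * Weighted sums over finitely generated semigroups *)

Section GeneratedSemigroup.
Variable R : realType.
Implicit Types (Lam : set R) (L : seq R) (v w : R -> R) (J : {fset R}).

(** Generators are peeled off one at a time, so that sums over the semigroup can be bounded by
    induction on the list. *)
Fixpoint gen_semigroup L : set R :=
  if L is x :: L' then
    [set y | exists n : nat, gen_semigroup L' (y - n%:R * x)]
  else [set 0].

Lemma gen_semigroup0 L : gen_semigroup L 0.
Proof. by elim: L => //= x L IH; exists 0%N; rewrite mul0r subr0. Qed.

Lemma gen_semigroupD L y z :
  gen_semigroup L y -> gen_semigroup L z -> gen_semigroup L (y + z).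
Proof.
elim: L y z => [|x L IH] y z /=; first by move=> -> ->; rewrite addr0.
move=> [n hn] [m hm]; exists (n + m)%N.
by have := IH _ _ hn hm; rewrite natrD mulrDl opprD addrACA.
Qed.

Lemma mem_gen_semigroup L x : x \in L -> gen_semigroup L x.
Proof.
elim: L => //= y L IH; rewrite inE => /orP[/eqP ->|/IH xL].
  by exists 1%N; rewrite mul1r subrr; exact: gen_semigroup0.
by exists 0%N; rewrite mul0r subr0.
Qed.

Lemma semigroup_mulrn Lam x n : semigroup0 Lam -> Lam x -> Lam (n%:R * x).
Proof.
case=> L0 _ LD Lx; elim: n => [|n IH]; first by rewrite mul0r.
by rewrite -natr1 mulrDl mul1r; exact: LD.
Qed.

Lemma gen_semigroup_sub Lam L : semigroup0 Lam -> (forall x, x \in L -> Lam x) ->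
  gen_semigroup L `<=` Lam.
Proof.
move=> hLam; have [L0 _ LD] := hLam; elim: L => [|x L IH] LL y /=.
  by move=> ->.
move=> [n hn]; rewrite -(subrK (n%:R * x) y); apply: LD.
  by apply: IH hn => z zL; apply: LL; rewrite inE zL orbT.
by apply: semigroup_mulrn => //; apply: LL; rewrite inE eqxx.
Qed.

Lemma gen_semigroup_semigroup0 Lam L : semigroup0 Lam ->
  (forall x, x \in L -> Lam x) -> semigroup0 (gen_semigroup L).
Proof.
move=> hLam LL; split; first exact: gen_semigroup0.
  by move=> y /(gen_semigroup_sub hLam LL); case: hLam => _ + _; apply.
exact: gen_semigroupD.
Qed.

(** Induction on the generators: with l = n x + l', submultiplicativity bounds the sum by the sum
    over n times the sum over l'. *)
Lemma gen_semigroup_sum Lam L v : semigroup0 Lam -> (forall x, x \in L -> Lam x) ->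
  (forall y, Lam y -> 0 <= v y) ->
  (forall y z, Lam y -> Lam z -> v (y + z) <= v y * v z) ->
  (forall x, x \in L -> exists K, forall N, \sum_(n < N) v (n%:R * x) <= K) ->
  exists K, forall J, \sum_(l <- J | `[< gen_semigroup L l >]) v l <= K.
Proof.
move=> hLam + v0 vM; elim: L => [|x L IH] LL LK /=.
  exists (v 0) => J; have v00 : 0 <= v 0 by apply: v0; case: hLam.
  have [J0|J0] := boolP (0 \in J); last first.
    rewrite big1_fset// => l lJ /asboolP /= l0; by rewrite -l0 lJ in J0.
  rewrite big_mkcond (big_fsetD1 0)//= big1_fset ?addr0.
    by case: asboolP.
  move=> l; rewrite !inE => /andP[/eqP l0 _] _; by case: asboolP.
have [|y yL|K2 hK2] := IH.
- by move=> y yL; apply: LL; rewrite inE yL orbT.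
- by apply: LK; rewrite inE yL orbT.
have [|K1 hK1] := LK x; first by rewrite inE eqxx.
have Lx : Lam x by apply: LL; rewrite inE eqxx.
have LL' : forall y, gen_semigroup L y -> Lam y.
  by apply: gen_semigroup_sub => // y yL; apply: LL; rewrite inE yL orbT.
exists (K1 * K2) => J.
(* One representation l = n x + l' is fixed for each [l]; off the semigroup 0 is a dummy value. *)
have nu_ex l : exists n : nat, gen_semigroup (x :: L) l ->
    gen_semigroup L (l - n%:R * x).
  have [[n hn]|hl] := pselect (gen_semigroup (x :: L) l); first by exists n.
  by exists 0%N.
have [nu hnu] := choice nu_ex.
pose N := (\max_(l <- J) nu l).+1.
pose g n l := if `[< gen_semigroup L (l - n%:R * x) >]
  then v (n%:R * x) * v (l - n%:R * x) else 0.
have g0 n l : 0 <= g n l.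
  rewrite /g; case: asboolP => // /LL' hl.
  by rewrite mulr_ge0// v0//; exact: semigroup_mulrn.
have K20 : 0 <= K2 by have := hK2 fset0; rewrite big_mkcond big_seq_fset0.
apply: (@le_trans _ _ (\sum_(l <- J) \sum_(n < N) g n l)).
  rewrite big_mkcond big_seq [leRHS]big_seq; apply: ler_sum => l lJ.
  case: asboolP => hl; last exact: sumr_ge0.
  have nuN : (nu l < N)%N by rewrite ltnS; exact: leq_bigmax_seq.
  rewrite (bigD1 (Ordinal nuN))//= -[v l]addr0; apply: lerD; last exact: sumr_ge0.
  rewrite /g asboolT; last exact: hnu.
  rewrite -{1}(subrK ((nu l)%:R * x) l) [leRHS]mulrC vM//; first exact/LL'/hnu.
  exact: semigroup_mulrn.
rewrite exchange_big /=.
apply: (@le_trans _ _ (\sum_(n < N) v (n%:R * x) * K2)); last first.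
  by rewrite -mulr_suml ler_wpM2r.
apply: ler_sum => n _.
have nx : 0 <= v (n%:R * x) by apply: v0; exact: semigroup_mulrn.
(* For fixed [n] the translation by -n x is injective, so the sum over [J] becomes one over a finite
   set of translates, to which the bound for the remaining generators applies. *)
apply: le_trans (ler_wpM2l nx (hK2 [fset l - n%:R * x | l in J]%fset)).
rewrite [X in _ <= _ * X]big_mkcond big_imfset /=; last first.
  by move=> y z _ _ /addIr.
rewrite mulr_sumr; apply: ler_sum => l _.
by rewrite /g; case: asboolP => _; rewrite ?mulr0.
Qed.

(** Root test: admissibility gives w(n x) <= e^{n x k / 2} for large n, and the other half of the
    decay e^{-n x k} leaves a convergent geometric series. *)
Lemma admissible_sum Lam w (x k : R) : is_weight Lam w -> admissible Lam w ->
  semigroup0 Lam -> Lam x -> x != 0 -> 0 < k ->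
  exists K, forall N, \sum_(n < N) w (n%:R * x) * expR (- (n%:R * x * k)) <= K.
Proof.
move=> hw hadm hLam Lx x0 k0; have [_ w1 _] := hw.
have xgt0 : 0 < x by rewrite lt0r x0; case: hLam => _ + _; apply.
have w0 n : 0 <= w (n%:R * x).
  by apply: le_trans (w1 _ _) => //; exact: semigroup_mulrn.
pose E := expR (x * k / 2).
have E0 : 0 <= E := expR_ge0 _.
have E1 : 0 < E - 1 by rewrite subr_gt0 expR_gt1 divr_gt0// mulr_gt0.
have /cvgrPdist_le/(_ _ E1)[N0 _ hN0] := hadm x Lx.
pose q := expR (- (x * k / 2)).
have q01 : 0 <= q < 1.
  by rewrite expR_ge0 -expR0 ltr_expR oppr_lt0 divr_gt0// mulr_gt0.
have qn n : expR (- (n%:R * x * k)) = q ^+ n * q ^+ n.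
  by rewrite -!expRM_natl -expRD; congr expR; field.
pose t n := w (n%:R * x) * expR (- (n%:R * x * k)).
have t0 n : 0 <= t n by rewrite mulr_ge0 ?expR_ge0.
(* Starting at [N0.+1] excludes n = 0, where taking the n-th root cannot be undone. *)
have ht n : (N0.+1 <= n)%N -> t n <= q ^+ n.
  move=> Nn; have n0 : n%:R != 0 :> R by rewrite pnatr_eq0 -lt0n (leq_ltn_trans _ Nn).
  have root : w (n%:R * x) `^ n%:R^-1 <= E.
    have := hN0 n (ltnW Nn); rewrite distrC => /(le_trans (ler_norm _)) /=.
    by rewrite lerD2r.
  have wE : w (n%:R * x) <= E ^+ n.
    have -> : w (n%:R * x) = (w (n%:R * x) `^ n%:R^-1) ^+ n.
      by rewrite -powR_mulrn ?powR_ge0// -powRrM mulVf// powRr1.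
    by apply: lerXn2r; rewrite ?nnegrE ?powR_ge0.
  have Eq : E * q = 1 by rewrite -expRD subrr expR0.
  rewrite /t qn mulrA -[leRHS]mul1r ler_wpM2r ?exprn_ge0 ?expR_ge0//.
  apply: le_trans (ler_wpM2r _ wE) _; first by rewrite exprn_ge0 ?expR_ge0.
  by rewrite -exprMn Eq expr1n.
exists (\sum_(n < N0.+1) t n + (1 - q)^-1) => N.
apply: le_trans (lerD (lexx _) (geometric_sum_le N q01)).
rewrite -(big_mkord xpredT t) -(big_mkord xpredT t) -(big_mkord xpredT (fun n => q ^+ n)).
have [NN|NN] := leqP N N0.+1.
  rewrite (@big_cat_nat _ _ _ N 0%N N0.+1)//= -addrA lerDl addr_ge0 ?sumr_ge0//.
  by move=> n _; rewrite exprn_ge0 ?expR_ge0.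
rewrite (@big_cat_nat _ _ _ N0.+1 0%N N)//= ?(ltnW NN)// lerD2l.
rewrite [leRHS](@big_cat_nat _ _ _ N0.+1 0%N N)//= ?(ltnW NN)//.
apply: ler_wpDl; first by apply: sumr_ge0 => n _; rewrite exprn_ge0 ?expR_ge0.
by rewrite big_nat [leRHS]big_nat; apply: ler_sum => n /andP[/ht].
Qed.

(* Elements of the semigroup are combinations [sum_i n_i x_i], so the sum is dominated by the product over the generators [x] of the sums bounded in [admissible_sum]. *)
Lemma gen_semigroup_weight_sum Lam L w (k : R) : semigroup0 Lam -> is_weight Lam w ->
  admissible Lam w -> (forall x, x \in L -> Lam x /\ x != 0) -> 0 < k ->
  exists K, forall J,
    \sum_(l <- J | `[< gen_semigroup L l >]) w l * expR (- (l * k)) <= K.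
Proof.
move=> hLam hw hadm LL k0; have [_ w1 wM] := hw.
apply: (@gen_semigroup_sum Lam L (fun l => w l * expR (- (l * k)))) => //.
- by move=> x /LL[].
- by move=> y Ly /=; rewrite mulr_ge0 ?expR_ge0//; exact: le_trans (w1 _ Ly).
- move=> y z Ly Lz /=; rewrite mulrDl opprD expRD mulrACA.
  by apply: ler_wpM2r; rewrite ?wM ?mulr_ge0 ?expR_ge0.
by move=> x /LL[Lx x0]; exact: admissible_sum hadm hLam Lx x0 k0.
Qed.

End GeneratedSemigroup.

(** * Inversion of scalar Dirichlet series *)

Section ScalarInverse.
Variable R : realType.
Implicit Types (r : seq (R * R[i])) (k : R) (s : R[i]).

Definition dpoly r s : R[i] := \sum_(x <- r) x.2 * dexp x.1 s.

(** A Lipschitz constant, in the norm with weight 1, for real shifts k >= -1 of the polynomial: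
    there e^{-l k} varies in [k] with slope at most l e^l. *)
Definition slope r : R := \sum_(x <- r) modc x.2 * (x.1 * expR x.1).

Lemma expR_lipschitz (l k k' : R) : 0 <= l -> - 1 <= k -> - 1 <= k' ->
  `|expR (- (l * k)) - expR (- (l * k'))| <= l * expR l * `|k - k'|.
Proof.
move=> l0; wlog kk' : k k' / k <= k' => [hwlog k1 k1'|k1 _].
  have [/hwlog|/ltW/hwlog] := leP k k'; first exact.
  by rewrite distrC (distrC k); exact.
have -> : expR (- (l * k')) = expR (- (l * k)) * expR (- (l * (k' - k))).
  by rewrite -expRD; congr expR; ring.
rewrite (distrC k) (ger0_norm (_ : 0 <= k' - k)) ?subr_ge0//.
have lk : 0 <= l * (k' - k) by rewrite mulr_ge0// subr_ge0.
have E1 : expR (- (l * (k' - k))) <= 1 by rewrite -[leRHS]expR0 ler_expR oppr_le0.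
rewrite -{1}[expR (- (l * k))]mulr1 -mulrBr normrM (ger0_norm (expR_ge0 _)).
rewrite ger0_norm ?subr_ge0//.
have -> : l * expR l * (k' - k) = expR l * (l * (k' - k)) by ring.
apply: ler_pM; rewrite ?expR_ge0 ?subr_ge0//.
  by rewrite ler_expR -mulrN ler_piMr// lerNl.
by have := expR_ge1Dx (- (l * (k' - k))); lra.
Qed.

Lemma Re_addr s k : complex.Re (s + (k%:C)%C) = complex.Re s + k.
Proof. by case: s. Qed.

Lemma weight1 (G : set R) : is_weight G (fun=> 1).
Proof. by split=> // *; rewrite mulr1. Qed.

Lemma admissible1 (G : set R) : admissible G (fun=> 1).
Proof.
move=> l _; under eq_fun do rewrite powR1; exact: cvg_cst.
Qed.

(** * Inverses of Dirichlet polynomials bounded below on the half-plane *)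

Section Polynomial.
Variables (G : set R) (r : seq (R * R[i])) (d : R).
Hypotheses (hG : semigroup0 G) (rG : forall x, x \in r -> G x.1).
Hypothesis Pd : forall s, 0 <= complex.Re s -> d <= modc (dpoly r s).

Lemma slope_ge0 : 0 <= slope r.
Proof.
rewrite /slope big_seq; apply: sumr_ge0 => x /rG Gx; have [_ G0 _] := hG.
by rewrite !mulr_ge0 ?modc_ge0 ?expR_ge0 ?G0.
Qed.

Lemma dpoly_lipschitz k k' : - 1 <= k -> - 1 <= k' ->
  in_ball G (fun=> 1) (slope r * `|k - k'|)
    (fun s => dpoly r (s + (k%:C)%C) - dpoly r (s + (k'%:C)%C)).
Proof.
move=> k1 k1'; have [_ G0 _] := hG.
pose b (x : R * R[i]) := x.2 * ((expR (- (x.1 * k)) - expR (- (x.1 * k')))%:C)%C.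
have h := @in_ball_sum _ _ _ (weight1 G) _ r (mem r)
   (fun x s => b x * dexp x.1 s) (fun x => modc (b x) * 1)
   (fun x xr => in_ball_monomial (weight1 G) (b x) (rG xr)).
apply: in_ball_le (in_ball_ext _ h).
  rewrite /slope mulr_suml [leRHS]big_seq; apply: ler_sum => x xr.
  rewrite mulr1 modcM modc_real -mulrA ler_wpM2l ?modc_ge0//.
  by apply: expR_lipschitz => //; exact/G0/rG.
move=> s _; rewrite /dpoly -sumrB [RHS]big_seq; apply: eq_bigr => x _.
by rewrite /b !dexpDr !dexp_real rmorphB /=; ring.
Qed.

Let C := slope r.

(** A shift to the left by at most [h] changes the values by at most C h; a shift to the right stays
    in the half-plane. *)
Lemma dpoly_lower k (h : R) s : 0 <= h <= 1 -> - h <= k -> 0 <= complex.Re s ->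
  d - C * h <= modc (dpoly r (s + (k%:C)%C)).
Proof.
move=> /andP[h0 h1] hk s0; have C0 : 0 <= C := slope_ge0.
have [k0|k0] := leP 0 k.
  apply: le_trans (Pd _); last by rewrite Re_addr addr_ge0.
  by rewrite lerBlDr lerDl mulr_ge0.
have k1 : - 1 <= k by rewrite (le_trans _ hk)// lerN2.
have k00 : - 1 <= 0 :> R by rewrite oppr_le0.
have := in_ball_bound hG (weight1 G) (dpoly_lipschitz k1 k00) s0.
rewrite subr0 addr0 => b1; have b2 := Pd s0.
have b3 : C * `|k| <= C * h by rewrite ler_wpM2l// ltr0_norm// lerNl.
have := modc_triangle (dpoly r (s + (k%:C)%C)) (dpoly r s) 0.
rewrite !subr0 (modcBC (dpoly r s)) => b4.
rewrite -/C in b1; lra.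
Qed.

Hypothesis d0 : 0 < d.
(** The step length of the propagation, chosen so that h <= 1 and C h <= d / 4; the lower bound [D]
    on Re s >= -h is then at least 3 d / 4. *)
Let h := d / (4 * (C + d)).
Let D := d - C * h.

Let C0 : 0 <= C. Proof. exact: slope_ge0. Qed.
Let Cd0 : 0 < C + d. Proof. by rewrite ltr_wpDl. Qed.
Let h_gt0 : 0 < h. Proof. by rewrite divr_gt0// mulr_gt0. Qed.
Let h_le1 : h <= 1.
Proof. by rewrite ler_pdivrMr ?mulr_gt0// mul1r; move: C0 d0; lra. Qed.
Let Ch : C * h <= d / 4.
Proof.
have -> : C * h = (C / (C + d)) * (d / 4).
  by rewrite /h; field; rewrite gt_eqF.
rewrite ler_piMl ?divr_ge0 1?ltW//.
by rewrite ltr_pdivrMr// mul1r ltrDl.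
Qed.
Let D_ge : d * (3 / 4) <= D. Proof. by rewrite /D; move: Ch; lra. Qed.
Let D_gt0 : 0 < D. Proof. by apply: lt_le_trans D_ge; rewrite mulr_gt0. Qed.
Let h01 : 0 <= h <= 1. Proof. by rewrite h_le1 ltW. Qed.

Let shifted_inv k s := (dpoly r (s + (k%:C)%C))^-1.

Let dpoly_lower_D k s : - h <= k -> 0 <= complex.Re s ->
  D <= modc (dpoly r (s + (k%:C)%C)).
Proof. exact: dpoly_lower. Qed.

Let dpoly_neq0 k s : - h <= k -> 0 <= complex.Re s ->
  dpoly r (s + (k%:C)%C) != 0.
Proof.
by move=> hk s0; rewrite -modc_gt0; apply: lt_le_trans (dpoly_lower_D hk s0).
Qed.

Let shifted_invX_le k n s : - h <= k -> 0 <= complex.Re s ->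
  modc (shifted_inv k s ^+ n) <= D^-1 ^+ n.
Proof.
move=> hk s0; rewrite modcX modcV lerXn2r ?nnegrE ?invr_ge0 ?modc_ge0 ?(ltW D_gt0)//.
by rewrite lef_pV2 ?posrE ?dpoly_lower_D// modc_gt0 dpoly_neq0.
Qed.

(** One step to the left, with 1 / p(s + k + 2 h) as approximate inverse of p(s + k). Its powers are
    shifts by [h] of the powers of [shifted_inv (k + h)], whose suprema are at most D^(-n), so
    [in_ball_shift] bounds their norms by K D^(-n). *)
Lemma shifted_inv_step k (K : R) : - h <= k ->
  (forall J : {fset R}, \sum_(l <- J | `[< G l >]) 1 * expR (- (l * h)) <= K) ->
  (exists c, in_ball G (fun=> 1) c (shifted_inv (k + h))) ->
  exists c, in_ball G (fun=> 1) c (shifted_inv k).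
Proof.
move=> hk hK [c kc].
have kh : - h <= k + h by rewrite (le_trans hk)// lerDl ltW.
have khh : - h <= k + h + h by rewrite (le_trans kh)// lerDl ltW.
have lem1 x : - h <= x -> - 1 <= x by apply: le_trans; rewrite lerN2.
apply: (@in_ball_inv _ _ _ hG (weight1 G) (C * `|k - (k + h + h)|) D^-1 K _
  (shifted_inv (k + h + h))).
- by rewrite invr_ge0 ltW.
(* The ratio is 2 C h / D, and 2 C h <= d / 2 < 3 d / 4 <= D. *)
- have -> : k - (k + h + h) = - (h + h) by ring.
  rewrite normrN ger0_norm ?addr_ge0 1?ltW// ltr_pdivrMr// mul1r mulrDr.
  by move: Ch D_ge d0; lra.
- move=> n; rewrite mulrC.
  have S_le s : 0 <= complex.Re s -> modc (shifted_inv (k + h) s ^+ n) <= D^-1 ^+ n.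
    exact: shifted_invX_le.
  apply: in_ball_ext (in_ball_shift hG (weight1 G) (weight1 G)
    (in_ballX hG (weight1 G) n kc) S_le (ltW h_gt0) hK) => s s0.
  by rewrite /shifted_inv -addrA -rmorphD /= (addrC h).
- apply: in_ball_ext (dpoly_lipschitz (lem1 _ hk) (lem1 _ khh)) => s _.
  by rewrite /shifted_inv invrK.
- by move=> s s0; rewrite invr_eq0 dpoly_neq0.
- by move=> s s0; rewrite dpoly_neq0.
Qed.

(* Far to the right the constant term dominates the polynomial. *)
Lemma shifted_inv_far : exists k0, 0 < k0 /\ forall k, k0 <= k ->
  exists c, in_ball G (fun=> 1) c (shifted_inv k).
Proof.
have [_ G0 _] := hG.
(* Since e^{-l k} <= 1 / (l k), the nonconstant part of p(s + k) has norm at most B / k. *)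
pose B := \sum_(x <- r | x.1 != 0) modc x.2 / x.1.
have B0 : 0 <= B.
  rewrite /B big_seq_cond; apply: sumr_ge0 => x /andP[/rG/G0 x0 _].
  by rewrite divr_ge0 ?modc_ge0.
(* Beyond this threshold B / k <= D / 4; the added 1 keeps it positive when B = 0. *)
exists ((4 * B + 1) / D); split.
  by rewrite divr_gt0// ltr_wpDl// mulr_ge0.
move=> k kB; have k0 : 0 < k.
  by apply: lt_le_trans kB; rewrite divr_gt0// ltr_wpDl// mulr_ge0.
have hk : - h <= k by rewrite (@le_trans _ _ 0) ?oppr_le0 1?ltW.
have BkD : B / k <= D / 4.
  rewrite ler_pdivrMr//; rewrite ler_pdivrMr// in kB; lra.
pose a0 := \sum_(x <- r | x.1 == 0) x.2.
pose b (x : R * R[i]) := x.2 * ((expR (- (x.1 * k)))%:C)%C.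
pose Q s := \sum_(x <- r | (x \in r) && (x.1 != 0)) b x * dexp x.1 s.
have dQ s : dpoly r (s + (k%:C)%C) - a0 = Q s.
  rewrite /dpoly (bigID (fun x => x.1 == 0)) /= addrC.
  rewrite [X in _ + X - _](_ : _ = a0).
    rewrite addrK /Q -big_seq_cond; apply: eq_bigr => x _.
    by rewrite /b dexpDr dexp_real -mulrA (mulrC (dexp _ _)).
  by apply: eq_bigr => x /eqP ->; rewrite dexp0l mulr1.
have Q_ball : in_ball G (fun=> 1) (B / k) Q.
  have mono x : (x \in r) && (x.1 != 0) -> in_ball G (fun=> 1) (modc (b x) * 1)
      (fun s => b x * dexp x.1 s).
    by move=> /andP[xr _]; exact (in_ball_monomial (weight1 G) (b x) (rG xr)).
  have := in_ball_sum (weight1 G) r mono; apply: in_ball_le.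
  rewrite /B mulr_suml [leRHS]big_seq_cond; apply: ler_sum => x /andP[/rG/G0 x0 xn0].
  have {xn0} x0 : 0 < x.1 by rewrite lt0r xn0.
  rewrite mulr1 modcM modc_real ger0_norm ?expR_ge0// -mulrA ler_wpM2l ?modc_ge0//.
  have xk : 0 < x.1 * k by rewrite mulr_gt0.
  rewrite -invfM expRN lef_pV2 ?posrE ?expR_gt0//.
  by have := expR_ge1Dx (x.1 * k); lra.
have Q_bound s : 0 <= complex.Re s -> modc (Q s) <= D / 4.
  by move=> s0; exact: le_trans (in_ball_bound hG (weight1 G) Q_ball s0) BkD.
(* With the nonconstant part at most D / 4, this makes the ratio of the geometric series at most
   1/3. *)
have a0_ge : D * (3 / 4) <= modc a0.
  have z0 : 0 <= complex.Re (0 : R[i]) by [].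
  have b1 := Q_bound _ z0; have b2 := dpoly_lower_D hk z0.
  have := modc_triangle a0 (dpoly r (0 + (k%:C)%C)) 0.
  rewrite !subr0 dQ => b3; lra.
have a0_gt0 : 0 < modc a0 by apply: lt_le_trans a0_ge; rewrite mulr_gt0.
apply: (@in_ball_inv _ _ _ hG (weight1 G) (B / k) (modc a0)^-1 1 _ (fun=> a0^-1)).
- by rewrite invr_ge0 modc_ge0.
- rewrite ltr_pdivrMr// mul1r; move: D_gt0; lra.
- by move=> n; rewrite mul1r -modcV -modcX; exact: in_ball_cst hG (weight1 G) _.
- by apply: in_ball_ext Q_ball => s _; rewrite invrK dQ.
- by move=> s _; rewrite invr_eq0 -modc_gt0.
- by move=> s s0; rewrite dpoly_neq0.
Qed.

(** The descent to the shift -h takes place with weight 1, using [K1]. A last shift back by [h]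
    brings in the weight [w], using [K], and bounds the powers of 1/p at the rate 1/D <= 1 / (3 d /
    4). *)
Lemma dpoly_invX_ball (w : R -> R) (K1 K : R) : is_weight G w ->
  (forall J : {fset R}, \sum_(l <- J | `[< G l >]) 1 * expR (- (l * h)) <= K1) ->
  (forall J : {fset R}, \sum_(l <- J | `[< G l >]) w l * expR (- (l * h)) <= K) ->
  forall n, in_ball G w (K * (d * (3 / 4))^-1 ^+ n) (fun s => (dpoly r s)^-1 ^+ n).
Proof.
move=> hw hK1 hK n.
have [c kc] : exists c, in_ball G (fun=> 1) c (shifted_inv (- h)).
  have [k0 [k00 far]] := shifted_inv_far.
  have down (N : nat) : (exists c, in_ball G (fun=> 1) c (shifted_inv (- h + N%:R * h)))
      -> exists c, in_ball G (fun=> 1) c (shifted_inv (- h)).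
    elim: N => [|N IH]; first by rewrite mul0r addr0.
    rewrite -natr1 mulrDl mul1r addrA => hN; apply: IH.
    apply: shifted_inv_step hK1 hN.
    by rewrite lerDl mulr_ge0// ltW.
  (* One extra step compensates for the start at -h, the other for the rounding down of k0 / h. *)
  apply: (down (Num.truncn (k0 / h)).+2); apply: far.
  rewrite -natr1 mulrDl mul1r addrC addrK -ler_pdivrMr//.
  by rewrite ltW// truncnS_gt.
have hh : - h <= - h by [].
have K0 : 0 <= K by have := hK fset0; rewrite big_mkcond big_seq_fset0.
have := in_ball_shift hG (weight1 G) hw (in_ballX hG (weight1 G) n kc)
  (fun s => shifted_invX_le n hh) (ltW h_gt0) hK.
move=> H; apply: in_ball_le (in_ball_ext _ H).
  rewrite mulrC ler_wpM2l// lerXn2r ?nnegrE ?invr_ge0 ?mulr_ge0 ?(ltW D_gt0) ?(ltW d0)//.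
  by rewrite lef_pV2 ?posrE ?mulr_gt0.
by move=> s _; rewrite /shifted_inv -addrA -rmorphD /= subrr addr0.
Qed.

End Polynomial.

Theorem scalar_inverse (Lam : set R) (w : R -> R) (c d : R) (f : R[i] -> R[i]) :
  semigroup0 Lam -> is_weight Lam w -> admissible Lam w -> in_ball Lam w c f ->
  0 < d -> (forall s, 0 <= complex.Re s -> d <= modc (f s)) ->
  exists c', in_ball Lam w c' (fun s => (f s)^-1).
Proof.
move=> hLam hw hadm fc d0 fd; have [w0 w1 wM] := hw.
(* A polynomial within d / 4 of [f] has modulus at least 3 d / 4; the powers of its inverse grow at
   rate 16 / (9 d), so the ratio of the final series is 4 / 9. *)
have d4 : 0 < d / 4 by rewrite divr_gt0.
have [r [rLam fr]] := in_ball_approx hLam hw fc d4.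
have Pd s : 0 <= complex.Re s -> d * (3 / 4) <= modc (dpoly r s).
  move=> s0; have b1 := in_ball_bound hLam hw fr s0; have b2 := fd s s0.
  have := modc_triangle (dpoly r s) (f s) 0; rewrite !subr0 => b3.
  rewrite -/(dpoly r s) in b1; lra.
(* The generator 0 is dropped because [admissible_sum] rests on decay along the multiples of a
   positive frequency; 0 lies in [G] anyway. *)
pose L := [seq x <- map fst r | x != 0]; pose G := gen_semigroup L.
have LLam x : x \in L -> Lam x /\ x != 0.
  rewrite mem_filter => /andP[x0 /mapP[y yr xy]].
  by split=> //; rewrite xy; exact: rLam.
have hG : semigroup0 G by apply: (gen_semigroup_semigroup0 hLam) => x /LLam[].
have GLam : G `<=` Lam by apply: gen_semigroup_sub => // x /LLam[].
have rG x : x \in r -> G x.1.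
  move=> xr; have [->|x0] := eqVneq x.1 0; first exact: gen_semigroup0.
  by apply: mem_gen_semigroup; rewrite mem_filter x0 map_f.
have wG : is_weight G w.
  split=> // [l /GLam/w1//|l m /GLam Ll /GLam Lm]; exact: wM.
have d1 : 0 < d * (3 / 4) by rewrite mulr_gt0.
(* The step length of the polynomial case, with lower bound 3 d / 4 in place of [d]. *)
set h := d * (3 / 4) / (4 * (slope r + d * (3 / 4))).
have h0 : 0 < h.
  by rewrite divr_gt0// mulr_gt0// ltr_wpDl// (slope_ge0 hG).
have [K1 hK1] := gen_semigroup_weight_sum hLam (weight1 Lam) (@admissible1 Lam) LLam h0.
have [K hK] := gen_semigroup_weight_sum hLam hw hadm LLam h0.
have PX := dpoly_invX_ball hG rG Pd d1 wG hK1 hK.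
apply: (@in_ball_inv _ _ _ hLam hw (d / 4) (d * (3 / 4) * (3 / 4))^-1 K _
  (fun s => (dpoly r s)^-1)).
- by rewrite invr_ge0 !mulr_ge0// ltW.
- by rewrite ltr_pdivrMr ?mulr_gt0// mul1r; move: d0; lra.
- by move=> n; exact: in_ball_sub GLam (PX n).
- by apply: in_ball_ext fr => s _; rewrite invrK.
- by move=> s s0; rewrite invr_eq0 -modc_gt0; apply: lt_le_trans (Pd s s0).
- by move=> s s0; rewrite -modc_gt0; apply: lt_le_trans (fd s s0).
Qed.

End ScalarInverse.

(** * Matrices *)

Section MatrixTopology.
Variable R : realType.

(** Balls in [C R] have complex radii; positivity in the order of the complex numbers forces the
    imaginary part to vanish, which yields a real radius. *)
Lemma nbhs_modcP (z : C R) (P : set (C R)) :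
  nbhs z P <-> exists2 e : R, 0 < e & forall z' : C R, modc (z' - z) <= e -> P z'.
Proof.
split=> [/nbhs_ballP[[e e'] /= e0 eP]|[e e0 eP]].
  move: e0; rewrite ltcE /= => /andP[/eqP e'0 e0].
  exists (e / 2); first by rewrite divr_gt0.
  move=> z' zz'; apply: eP; rewrite -ball_normE /= -/(modc (z - z')).
  rewrite normc_def ltcE /= e'0 eqxx /=.
  have := zz'; rewrite modcBC; case: (z - z') => x y /= /le_lt_trans; apply.
  by rewrite ltr_pdivrMr// ltr_pMr// ltr1n.
apply/nbhs_ballP; exists (e%:C)%C; first by rewrite /= ltcR.
move=> z'; rewrite -ball_normE /= => h; apply: eP; rewrite modcBC.
by move: h; case: (z - z') => x y; rewrite normc_def ltcR /= => /ltW.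
Qed.

Lemma finite_small (I : finType) (Q : I -> R -> Prop) :
  (forall i e e', e' <= e -> Q i e -> Q i e') ->
  (forall i, exists2 e, 0 < e & Q i e) -> exists2 e, 0 < e & forall i, Q i e.
Proof.
move=> Qle Qex.
suff [e e0 h] : exists2 e, 0 < e & forall i, i \in enum I -> Q i e.
  by exists e => // i; apply: h; rewrite mem_enum.
elim: (enum I) => [|i r [e1 e10 h1]]; first by exists 1.
have [e2 e20 h2] := Qex i; exists (Num.min e1 e2); first by rewrite lt_min e10.
move=> j; rewrite inE => /orP[/eqP ->|/h1].
  by apply: Qle h2; rewrite ge_min lexx orbT.
by apply: Qle; rewrite ge_min lexx.
Qed.

Lemma nbhs_mxP (d : nat) (M : 'M[C R]_d) (P : set 'M[C R]_d) :
  nbhs M P <-> exists2 e : R, 0 < e & forall N : 'M[C R]_d,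
    (forall i j, modc (N i j - M i j) <= e) -> P N.
Proof.
split=> [[B hB BP]|[e e0 eP]].
  have [e e0 he] := @finite_small ('I_d * 'I_d)%type
    (fun ij e => forall z', modc (z' - M ij.1 ij.2) <= e -> B ij.1 ij.2 z')
    (fun ij e e' e'e h z' hz' => h z' (le_trans hz' e'e))
    (fun ij => (nbhs_modcP _ _).1 (hB ij.1 ij.2)).
  by exists e => // N hN; apply: BP => i j; apply: (he (i, j)).
exists (fun i j => [set z' | modc (z' - M i j) <= e]).
  by move=> i j; apply/nbhs_modcP; exists e.
by move=> N; exact: eP.
Qed.

(** Continuity at [M] in terms of entrywise distances, the form in which [nbhs_mxP] describes
    neighbourhoods. *)
Definition entry_continuous (d : nat) (M : 'M[C R]_d) (phi : 'M[C R]_d -> R[i]) :=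
  forall e : R, 0 < e -> exists2 h : R, 0 < h & forall N : 'M[C R]_d,
    (forall i j, modc (N i j - M i j) <= h) -> modc (phi N - phi M) <= e.

Section EntryContinuous.
Variables (d : nat) (M : 'M[C R]_d).
Local Notation cts := (entry_continuous M).

Lemma entry_continuous_cst z : cts (fun=> z).
Proof. by move=> e e0; exists 1 => // N _; rewrite subrr modc0 ltW. Qed.

Lemma entry_continuous_entry i j : cts (fun N => N i j).
Proof. by move=> e e0; exists e => // N. Qed.

Lemma entry_continuousD phi psi : cts phi -> cts psi -> cts (fun N => phi N + psi N).
Proof.
move=> hphi hpsi e e0; have e2 : 0 < e / 2 by rewrite divr_gt0.
have [h1 h10 H1] := hphi _ e2; have [h2 h20 H2] := hpsi _ e2.
exists (Num.min h1 h2); first by rewrite lt_min h10.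
move=> N hN; rewrite opprD addrACA [leRHS]splitr.
apply: le_trans (modcD _ _) (lerD (H1 N _) (H2 N _)) => i j;
  by apply: le_trans (hN i j) _; rewrite ge_min lexx ?orbT.
Qed.

Lemma entry_continuousM phi psi : cts phi -> cts psi -> cts (fun N => phi N * psi N).
Proof.
move=> hphi hpsi e e0.
pose A := modc (phi M) + modc (psi M) + 1.
have A0 : 0 < A by rewrite ltr_wpDl// addr_ge0 ?modc_ge0.
(* The cap at 1 makes the product of the two increments at most [e1], so that the total error is at
   most e1 A. *)
pose e1 := Num.min 1 (e / A).
have e10 : 0 < e1 by rewrite lt_min ltr01 divr_gt0.
have [h1 h10 H1] := hphi _ e10; have [h2 h20 H2] := hpsi _ e10.
exists (Num.min h1 h2); first by rewrite lt_min h10.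
move=> N hN.
have {}H1 : modc (phi N - phi M) <= e1.
  by apply: H1 => i j; apply: le_trans (hN i j) _; rewrite ge_min lexx.
have {}H2 : modc (psi N - psi M) <= e1.
  by apply: H2 => i j; apply: le_trans (hN i j) _; rewrite ge_min lexx orbT.
have -> : phi N * psi N - phi M * psi M = (phi N - phi M) * (psi N - psi M)
   + (phi M * (psi N - psi M) + (phi N - phi M) * psi M) by ring.
have e1A : e1 * A <= e by rewrite -ler_pdivlMr// ge_min lexx orbT.
have e1_1 : e1 <= 1 by rewrite ge_min lexx.
apply: le_trans e1A; apply: le_trans (modcD _ _) _; rewrite !modcM.
apply: (@le_trans _ _ (e1 * 1 + (modc (phi M) * e1 + e1 * modc (psi M)))).
  apply: lerD.
    by apply: ler_pM; rewrite ?modc_ge0// (le_trans H2).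
  apply: le_trans (modcD _ _) _; rewrite !modcM.
  by apply: lerD; [apply: ler_wpM2l | apply: ler_wpM2r]; rewrite ?modc_ge0.
by rewrite /A; have : 0 <= e1 := ltW e10; lra.
Qed.

Lemma entry_continuous_sum (I : Type) (r : seq I) (phi : I -> 'M[C R]_d -> R[i]) :
  (forall i, cts (phi i)) -> cts (fun N => \sum_(i <- r) phi i N).
Proof.
move=> hphi; elim: r => [|i r IH] e e0.
  by have [h h0 H] := entry_continuous_cst 0 e0; exists h => // N /H; rewrite !big_nil.
have [h h0 H] := entry_continuousD (hphi i) IH e0.
by exists h => // N /H; rewrite !big_cons.
Qed.

Lemma entry_continuous_prod (I : Type) (r : seq I) (phi : I -> 'M[C R]_d -> R[i]) :
  (forall i, cts (phi i)) -> cts (fun N => \prod_(i <- r) phi i N).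
Proof.
move=> hphi; elim: r => [|i r IH] e e0.
  by have [h h0 H] := entry_continuous_cst 1 e0; exists h => // N /H; rewrite !big_nil.
have [h h0 H] := entry_continuousM (hphi i) IH e0.
by exists h => // N /H; rewrite !big_cons.
Qed.

Lemma entry_continuous_det : cts (fun N => \det N).
Proof.
rewrite /determinant; apply: entry_continuous_sum => s.
apply: entry_continuousM; first exact: entry_continuous_cst.
by apply: entry_continuous_prod => i; exact: entry_continuous_entry.
Qed.

End EntryContinuous.

(** Compactness of the segment gives a cluster point, and along an ultrafilter it is a limit:
    otherwise [U] would contain the set where [x] stays away from it. *)
Lemma ultra_bounded_cvg (T : Type) (U : set_system T) (x : T -> R) (c : R) :
  UltraFilter U -> (forall t, `|x t| <= c) ->
  exists p, forall e, 0 < e -> U [set t | `|x t - p| <= e].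
Proof.
move=> UU xc.
have xF : (x @ U) `[- c, c]%classic.
  apply: (@filterE _ U) => t /=; rewrite in_itv /= -ler_norml; exact: xc.
have [p [_ clp]] := @segment_compact R (- c) c (x @ U) _ xF.
exists p => e e0; have [//|UC] := in_ultra_setVsetC [set t | `|x t - p| <= e] UU.
have /clp/(_ (nbhsx_ballx p e e0))[y [ny]] : (x @ U) [set y | ~ `|y - p| <= e].
  exact: UC.
by rewrite -ball_normE /= distrC => /ltW.
Qed.

Lemma ultra_bounded_cvgC (T : Type) (U : set_system T) (x : T -> R[i]) (c : R) :
  UltraFilter U -> (forall t, modc (x t) <= c) ->
  exists p, forall e, 0 < e -> U [set t | modc (x t - p) <= e].
Proof.
move=> UU xc.
have [t|p hp] := @ultra_bounded_cvg T U (fun t => complex.Re (x t)) c UU.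
  exact: le_trans (modc_geRe _) (xc t).
have [t|q hq] := @ultra_bounded_cvg T U (fun t => complex.Im (x t)) c UU.
  exact: le_trans (modc_geIm _) (xc t).
exists (p +i* q)%C => e e0; have e2 : 0 < e / 2 by rewrite divr_gt0.
apply: filterS2 (hp _ e2) (hq _ e2) => t /= hp' hq'.
apply: le_trans (modc_leReIm _) _; rewrite [leRHS]splitr.
by move: hp' hq'; case: (x t) => a b /= ? ?; exact: lerD.
Qed.

(* A bounded family of matrices whose determinants come arbitrarily close to 0 accumulates, along an ultrafilter, at a singular matrix. *)
Lemma det_bounded_below (T : Type) (A : set T) (d : nat) (F : T -> 'M[C R]_d) (c : R) :
  (forall t i j, A t -> modc (F t i j) <= c) ->
  closure (F @` A) `<=` [set M : 'M[C R]_d | M \in unitmx] ->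
  exists2 e : R, 0 < e & forall t, A t -> e <= modc (\det (F t)).
Proof.
move=> Fc clF; apply: contrapT => hno.
have small (n : nat) : exists t, A t /\ modc (\det (F t)) < n.+1%:R^-1.
  apply: contrapT => hn; apply: hno; exists n.+1%:R^-1; first by rewrite invr_gt0 ltr0n.
  move=> t At; rewrite leNgt; apply/negP => lt; apply: hn; by exists t.
have [u hu] := choice small.
(* An ultrafilter refining [\oo] makes all entries converge at once, with no successive extraction
   of subsequences. *)
have [U [UU oU]] := ultraFilterLemma (eventually_filter : ProperFilter \oo).
have lim_ex (ij : 'I_d * 'I_d) : exists p, forall e, 0 < e ->
    U [set n | modc (F (u n) ij.1 ij.2 - p) <= e].
  by apply: (@ultra_bounded_cvgC _ _ _ c) => n; apply: Fc; exact: (hu n).1.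
have [p hp] := choice lim_ex.
pose M : 'M[C R]_d := \matrix_(i, j) p (i, j).
have near_M e : 0 < e -> U [set n | forall i j, modc (F (u n) i j - M i j) <= e].
  move=> e0.
  have := @filter_forall _ _ (fun ij => [set n | modc (F (u n) ij.1 ij.2 - p ij) <= e])
    U _ (fun ij => hp ij e e0).
  move=> hall; refine (@filterS _ U _ _ _ _ (hall _)) => n /= h i j.
  by rewrite mxE; exact: h (i, j).
have M_unit : M \in unitmx.
  apply: clF => B /nbhs_mxP[e e0 eB].
  have [n hn] := filter_ex (near_M e e0); exists (F (u n)); split; last exact: eB.
  by exists (u n) => //; exact: (hu n).1.
have detM : \det M = 0.
  apply/eqP; rewrite -modc_eq0 eq_le modc_ge0 andbT.
  apply/ler_addgt0Pr => e e0; rewrite add0r.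
  have e2 : 0 < e / 2 by rewrite divr_gt0.
  have [h h0 H] := entry_continuous_det M e2.
  have [k hk] := eventually_inv_le e2.
  have Uk : U [set n | (k <= n)%N] by apply: oU; exists k.
  have [n [hn kn]] := filter_ex (filterI (near_M h h0) Uk).
  have h3 := modc_triangle (\det (F (u n))) (\det M) 0.
  rewrite !subr0 (modcBC (\det M)) in h3; apply: le_trans h3 _.
  rewrite [leRHS]splitr lerD ?H// (le_trans (ltW (hu n).2))// (le_trans _ hk)//.
  by rewrite lef_pV2 ?posrE ?ltr0n// ler_nat.
by move: M_unit; rewrite unitmxE unitfE detM eqxx.
Qed.

(** By continuity, the determinant at a point of the closure is within e / 2 of some determinant of
    modulus at least [e], hence nonzero. *)
Lemma closure_det_neq0 (T : Type) (A : set T) (d : nat) (F : T -> 'M[C R]_d) (e : R) :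
  0 < e -> (forall t, A t -> e <= modc (\det (F t))) ->
  closure (F @` A) `<=` [set M : 'M[C R]_d | M \in unitmx].
Proof.
move=> e0 Fe M clM /=; rewrite unitmxE unitfE -modc_gt0.
have e2 : 0 < e / 2 by rewrite divr_gt0.
have [h h0 H] := entry_continuous_det M e2.
have [|_ [[t At <-] hN]] := clM [set N | forall i j, modc (N i j - M i j) <= h].
  by apply/nbhs_mxP; exists h.
have b1 := H _ hN; have b2 := Fe t At.
have := modc_triangle (\det M) (\det (F t)) 0; rewrite !subr0 => b3; lra.
Qed.

End MatrixTopology.

(** * Comparison of the operator norm with the entries *)

Section OperatorNorm.
Variables (R : realType) (d : nat).
Implicit Types (A : 'M[C R]_d) (v : 'cV[C R]_d).

Lemma sqr_modc (z : C R) :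
  complex.Re (z : R[i]) ^+ 2 + complex.Im (z : R[i]) ^+ 2 = modc z ^+ 2.
Proof. by case: z => a b /=; rewrite sqr_sqrtr// addr_ge0 ?sqr_ge0. Qed.

Lemma vnormE v : vnorm v = Num.sqrt (\sum_(i < d) modc (v i ord0) ^+ 2).
Proof. by congr Num.sqrt; apply: eq_bigr => i _; exact: sqr_modc. Qed.

Lemma modc_le_vnorm v i : modc (v i ord0) <= vnorm v.
Proof.
rewrite vnormE -[leLHS]ger0_norm ?modc_ge0// -sqrtr_sqr ler_wsqrtr//.
by rewrite (bigD1 i)//= lerDl sumr_ge0// => j _; rewrite sqr_ge0.
Qed.

Lemma vnorm_le_sum v : vnorm v <= \sum_(i < d) modc (v i ord0).
Proof.
have s0 (r : seq 'I_d) : 0 <= \sum_(i <- r) modc (v i ord0).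
  by apply: sumr_ge0 => i _; exact: modc_ge0.
rewrite vnormE -[leRHS]ger0_norm// -sqrtr_sqr ler_wsqrtr//.
elim: (index_enum _) => [|i r IH]; first by rewrite !big_nil sqr_ge0.
rewrite !big_cons sqrrD -addrA lerD2l (le_trans IH)// lerDr.
by rewrite mulrn_wge0// mulr_ge0 ?modc_ge0.
Qed.

Definition entry_sum A : R := \sum_(i < d) \sum_(j < d) modc (A i j).

Lemma vnorm_mul_le A v : vnorm v <= 1 -> vnorm (A *m v) <= entry_sum A.
Proof.
move=> v1; apply: le_trans (vnorm_le_sum _) _; apply: ler_sum => i _.
rewrite mxE; apply: le_trans (modc_sum _ _ _) _; apply: ler_sum => j _.
rewrite modcM ler_piMr ?modc_ge0//.
exact: le_trans (modc_le_vnorm _ _) v1.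
Qed.

Let images A := [set vnorm (A *m v) | v in [set v : 'cV[C R]_d | vnorm v <= 1]].

Lemma vnorm0 : vnorm (0 : 'cV[C R]_d) = 0.
Proof. by rewrite vnormE big1 ?sqrtr0// => i _; rewrite mxE modc0 expr0n. Qed.

Lemma images_neq0 A : images A !=set0.
Proof. by exists (vnorm (A *m 0)); exists 0 => //=; rewrite vnorm0. Qed.

Lemma images_ub A : ubound (images A) (entry_sum A).
Proof. by move=> _ [v v1 <-]; exact: vnorm_mul_le. Qed.

Lemma opnorm_le_entry_sum A : opnorm A <= entry_sum A.
Proof. by apply: ge_sup; [exact: images_neq0|exact: images_ub]. Qed.

Lemma vnorm_le_opnorm A v : vnorm v <= 1 -> vnorm (A *m v) <= opnorm A.
Proof.
move=> v1; apply: ub_le_sup; first by exists (entry_sum A); exact: images_ub.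
by exists v.
Qed.

Lemma opnorm_ge0 A : 0 <= opnorm A.
Proof.
apply: (@le_trans _ _ (vnorm (A *m 0))); first exact: sqrtr_ge0.
by rewrite vnorm_le_opnorm ?vnorm0.
Qed.

(** The entry is a coordinate of the image of the basis vector of index [j], whose norm is at most
    1. *)
Lemma modc_entry_le_opnorm A i j : modc (A i j) <= opnorm A.
Proof.
have -> : A i j = (A *m (delta_mx j 0 : 'cV_d)) i ord0 by rewrite -colE mxE.
apply: le_trans (modc_le_vnorm _ _) (vnorm_le_opnorm _ _).
apply: le_trans (vnorm_le_sum _) _.
rewrite (bigD1 j)// mxE !eqxx big1 => [|k /negbTE kj]; last first.
  by rewrite mxE kj; exact: modc0.
by rewrite -[leLHS]/(modc (1 : R[i]) + 0) addr0 modc1.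
Qed.

End OperatorNorm.

(** * Matrix-valued series through their scalar entries *)

Section MatrixDirichlet.
Variables (R : realType) (Lam : set R) (w : R -> R).
Hypotheses (hLam : semigroup0 Lam) (hw : is_weight Lam w).

Definition in_dirichlet (f : R[i] -> R[i]) := exists c, in_ball Lam w c f.

Let w_ge0 l : Lam l -> 0 <= w l.
Proof. by case: hw => _ + _ => /(_ l) h /h; exact: le_trans. Qed.

Lemma in_dirichlet_ext f g : (forall s, 0 <= complex.Re s -> f s = g s) ->
  in_dirichlet f -> in_dirichlet g.
Proof. by move=> fg [c fc]; exists c; exact: in_ball_ext fc. Qed.

Lemma in_dirichlet_cst z : in_dirichlet (fun=> z).
Proof. by exists (modc z); exact: in_ball_cst. Qed.

Lemma in_dirichletM f g : in_dirichlet f -> in_dirichlet g -> in_dirichlet (fun s => f s * g s).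
Proof. by move=> [c fc] [c' gc]; exists (c * c'); exact: in_ballM. Qed.

Lemma in_dirichlet_sum (I : Type) (r : seq I) (f : I -> R[i] -> R[i]) :
  (forall i, in_dirichlet (f i)) -> in_dirichlet (fun s => \sum_(i <- r) f i s).
Proof.
move=> /choice[c fc]; exists (\sum_(i <- r) c i).
by apply: in_ball_sum.
Qed.

Lemma in_dirichlet_prod (I : Type) (r : seq I) (f : I -> R[i] -> R[i]) :
  (forall i, in_dirichlet (f i)) -> in_dirichlet (fun s => \prod_(i <- r) f i s).
Proof.
move=> hf; elim: r => [|i r IH].
  by apply: in_dirichlet_ext (in_dirichlet_cst 1) => s _; rewrite big_nil.
by apply: in_dirichlet_ext (in_dirichletM (hf i) IH) => s _; rewrite big_cons.
Qed.

Lemma in_dirichlet_det (d : nat) (F : R[i] -> 'M[R[i]]_d) :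
  (forall i j, in_dirichlet (fun s => F s i j)) -> in_dirichlet (fun s => \det (F s)).
Proof.
move=> hF; rewrite /determinant; apply: in_dirichlet_sum => p.
by apply: in_dirichletM; [exact: in_dirichlet_cst|exact: in_dirichlet_prod].
Qed.

Lemma in_dirichlet_adj (d : nat) (F : R[i] -> 'M[R[i]]_d) i j :
  (forall i j, in_dirichlet (fun s => F s i j)) -> in_dirichlet (fun s => (\adj (F s)) i j).
Proof.
move=> hF; apply: (@in_dirichlet_ext (fun s => cofactor (F s) j i)).
  by move=> s _; rewrite mxE.
rewrite /cofactor; apply: in_dirichletM; first exact: in_dirichlet_cst.
apply: in_dirichlet_det => k l.
by apply: in_dirichlet_ext (hF (lift j k) (lift i l)) => s _; rewrite !mxE.
Qed.

(** [\esum] is the supremum over finite subsets, so a uniform real bound on finite sums makes it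
    finite. *)
Lemma esum_finite_sums (g : R -> R) (c : R) : (forall l, Lam l -> 0 <= g l) ->
  (forall J : {fset R}, \sum_(l <- J | `[< Lam l >]) g l <= c) ->
  (\esum_(l in Lam) (g l)%:E < +oo)%E.
Proof.
move=> g0 gc; apply: (@le_lt_trans _ _ c%:E); last exact: ltry.
apply: ge_ereal_sup => _ [A [fA AL] <-].
rewrite fsbig_finite//= sumEFin lee_fin.
apply: le_trans (gc (fset_set A)).
rewrite big_seq [leRHS]big_seq_cond (eq_bigl (fun l => (l \in fset_set A) && `[< Lam l >]))// => l.
have [lA|//] := boolP (l \in fset_set A); rewrite andTb.
by move: lA; rewrite in_fset_set// => /set_mem/AL Ll; apply/esym/asboolP.
Qed.

Lemma finite_sums_esum (g : R -> R) : (forall l, Lam l -> 0 <= g l) ->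
  (\esum_(l in Lam) (g l)%:E < +oo)%E ->
  exists c, forall J : {fset R}, \sum_(l <- J | `[< Lam l >]) g l <= c.
Proof.
move=> g0 goo; have gfin : (\esum_(l in Lam) (g l)%:E)%E \is a fin_num.
  by rewrite ge0_fin_numE// esum_ge0// => l Ll; rewrite lee_fin g0.
exists (fine (\esum_(l in Lam) (g l)%:E)%E) => J.
rewrite -lee_fin fineK//.
pose A := [fset l in J | `[< Lam l >]]%fset.
apply: esum_ge; exists [set` A].
  split; first exact: finite_fset.
  by move=> l /=; rewrite !inE => /andP[_ /asboolP].
by rewrite fsbig_finite//= set_fsetK sumEFin lee_fin big_fset_condE.
Qed.

Lemma dpartial_entry (d : nat) (a : R -> 'M[C R]_d) s (J : {fset R}) i j :
  (dpartial Lam a s J) i j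
  = \sum_(l <- J) (if `[< Lam l >] then a l i j else 0 : R[i]) * dexp l s.
Proof.
rewrite /dpartial summxE big_mkcond; apply: eq_bigr => l _.
by case: asboolP => _; rewrite ?mul0r// mxE mulrC.
Qed.

(** Entries are dominated by the operator norm. Coefficients off [Lam], which [inD] leaves
    arbitrary, are reset to 0 as [has_coefs] demands. *)
Lemma inD_entry (d : nat) (F : C R -> 'M[C R]_d) i j :
  inD Lam w F -> in_dirichlet (fun s => F s i j).
Proof.
move=> [a [afin aF]].
have g0 l : Lam l -> 0 <= opnorm (a l) * w l.
  by move=> Ll; rewrite mulr_ge0 ?opnorm_ge0 ?w_ge0.
have [c hc] := finite_sums_esum g0 afin.
exists c; exists (fun l => if `[< Lam l >] then a l i j else 0); split.
- by move=> l Ll; case: asboolP.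
- move=> J; apply: le_trans (hc J); rewrite [leRHS]big_mkcond.
  apply: ler_sum => l _; case: asboolP => Ll; last by rewrite modc0 mul0r.
  by rewrite ler_wpM2r ?w_ge0// modc_entry_le_opnorm.
move=> s s0 e e0.
have nF : nbhs (F s) [set N : 'M[C R]_d | modc (N i j - F s i j) <= e].
  by apply/nbhs_mxP; exists e => // N; exact.
have [J0 _ hJ0] := aF s s0 _ nF; exists J0 => J J0J.
by have := hJ0 J J0J; rewrite /= dpartial_entry.
Qed.

(** The operator norm is at most the sum of the moduli of the entries, so the norm bounds of the
    finitely many entries add up. *)
Lemma inD_of_entries (d : nat) (F : C R -> 'M[C R]_d) :
  (forall i j, in_dirichlet (fun s => F s i j)) -> inD Lam w F.
Proof.
move=> hF.
have /choice[cb hcb] (ij : 'I_d * 'I_d) : exists cb : R * (R -> R[i]),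
    has_coefs Lam w cb.1 cb.2 (fun s => F s ij.1 ij.2).
  by have [c [b hb]] := hF ij.1 ij.2; exists (c, b).
pose a l : 'M[C R]_d := \matrix_(i, j) (cb (i, j)).2 l.
exists a; split.
  apply: (@esum_finite_sums _ (\sum_(i < d) \sum_(j < d) (cb (i, j)).1)).
    by move=> l Ll; rewrite mulr_ge0 ?opnorm_ge0 ?w_ge0.
  move=> J; apply: (@le_trans _ _
      (\sum_(l <- J) \sum_(i < d) \sum_(j < d) modc ((cb (i, j)).2 l) * w l)).
    rewrite big_mkcond; apply: ler_sum => l _; case: asboolP => Ll; last first.
      apply: sumr_ge0 => i _; apply: sumr_ge0 => j _.
      exact (coefs_ge0 hw (hcb (i, j)) l).
    under eq_bigr do rewrite -mulr_suml.
    rewrite -mulr_suml ler_wpM2r ?w_ge0//.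
    apply: le_trans (opnorm_le_entry_sum _) _; rewrite /entry_sum.
    by apply: ler_sum => i _; apply: ler_sum => j _; rewrite mxE.
  rewrite exchange_big; apply: ler_sum => i _.
  rewrite exchange_big; apply: ler_sum => j _.
  by have [_ + _] := hcb (i, j); apply.
move=> s s0 B /nbhs_mxP[e e0 eB].
have conv ij : totally [set J : {fset R} |
    modc (dpartial Lam a s J ij.1 ij.2 - F s ij.1 ij.2) <= e].
  have [a0 _ /(_ s s0 e e0)[J0 hJ0]] := hcb ij; exists J0 => // J /hJ0 /=.
  rewrite dpartial_entry; congr (modc (_ - _) <= _); apply: eq_bigr => l _.
  case: asboolP => [_|/a0 ->]; last by rewrite mul0r.
  by rewrite mxE -surjective_pairing.
have := @filter_forall _ _ (fun ij => [set J : {fset R} |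
    modc (dpartial Lam a s J ij.1 ij.2 - F s ij.1 ij.2) <= e]) totally _ conv.
move=> hall; refine (@filterS _ totally _ _ _ _ (hall _)) => J hJ.
by apply: eB => i j; exact: (hJ (i, j)).
Qed.

End MatrixDirichlet.

(** * The inversion criterion for matrix-valued series *)

Unset Implicit Arguments.
Set Strict Implicit.
Set Printing Implicit Defensive.

Theorem mainTheorem6 (R : realType) (d : nat) (Lam : set R) (w : R -> R)
  (hLam : semigroup0 Lam) (hw : is_weight Lam w) (hadm : admissible Lam w)
  (F : C R -> 'M[C R]_d) (hF : inD Lam w F) :
  (exists G : C R -> 'M[C R]_d, inD Lam w G /\
     forall s, Hplane R s -> F s *m G s = 1%:M /\ G s *m F s = 1%:M)
  <-> closure (F @` Hplane R) `<=` [set M : 'M[C R]_d | M \in unitmx].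
Proof.
have Fent i j : in_dirichlet Lam w (fun s => F s i j) := inD_entry hw i j hF.
split=> [[G [hG FG]]|clF].
  (* Here det F det G = 1 with |det G| <= c < c + 1, so |det F| >= 1 / (c + 1) on the half-plane. *)
  have [c detG] := in_dirichlet_det hLam hw (fun i j => inD_entry hw i j hG).
  have c1 : 0 < c + 1 by rewrite ltr_wpDl// (in_ball_ge0 detG).
  apply: (@closure_det_neq0 _ _ _ _ _ (c + 1)^-1); first by rewrite invr_gt0.
  move=> s s0; have b1 := in_ball_bound hLam hw detG s0.
  have [FG1 _] := FG s s0.
  have b2 : modc (\det (F s)) * modc (\det (G s)) = 1.
    by rewrite -modcM -det_mulmx FG1 det1 modc1.
  rewrite -[leLHS]mul1r ler_pdivrMr// -[leLHS]b2 ler_wpM2l ?modc_ge0//.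
  by apply: le_trans b1 _; rewrite lerDl.
have /choice[c hc] (ij : 'I_d * 'I_d) : exists c, in_ball Lam w c (fun s => F s ij.1 ij.2).
  exact: Fent.
have c0 ij : 0 <= c ij := in_ball_ge0 (hc ij).
(* The compactness argument asks for one bound common to all entries; the sum of their radii
   serves. *)
have F_le s i j : Hplane R s -> modc (F s i j) <= \sum_ij c ij.
  move=> s0; apply: le_trans (in_ball_bound hLam hw (hc (i, j)) s0) _.
  by rewrite (bigD1 (i, j))//= lerDl sumr_ge0.
have [e e0 he] := det_bounded_below F_le clF.
have [cd hdet] := in_dirichlet_det hLam hw Fent.
have [c' hinv] := scalar_inverse hLam hw hadm hdet e0 he.
exists (fun s => (\det (F s))^-1 *: \adj (F s)); split.
  apply: (inD_of_entries hw) => i j.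
  apply: in_dirichlet_ext (in_dirichletM hLam hw (ex_intro _ c' hinv) (in_dirichlet_adj hLam hw i j Fent)).
  by move=> s _; rewrite [RHS]mxE.
move=> s s0; have dn0 : \det (F s) != 0.
  by rewrite -modc_gt0; apply: lt_le_trans (he s s0).
rewrite -scalemxAl -scalemxAr mul_mx_adj mul_adj_mx.
by rewrite scale_scalar_mx mulVf.
Qed.
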